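(* For all generic values of $\tau,x_0,x_{\bar0},x_1,\dots,x_L\in\mathbb C$, the partition function satisfies \[ \mathcal M_0\,Z_\tau(X)+\sum_{i=1}^L\mathcal N_i\,Z_\tau(X_i^0)+\sum_{i=1}^L\bar{\mathcal N}_i\,Z_\tau(X_i^{\bar0})=0, \] with \[ \mathcal M_0=\prod_{j=1}^L\frac{[x_0-x_j+\gamma][x_0-\mu_j][x_{\bar0}-\mu_j+\gamma]}{[x_0-x_j][x_0-\mu_j+\gamma]}-\prod_{j=1}^L\frac{[x_{\bar0}-x_j+\gamma][x_{\bar0}-\mu_j]}{[x_{\bar0}-x_j]}, \] \[ \mathcal N_i=-\frac{[\gamma][x_0-x_i+\tau+(L+1)\gamma]}{[\tau+(L+1)\gamma][x_0-x_i]}\prod_{j=1}^L\frac{[x_i-\mu_j][x_{\bar0}-\mu_j+\gamma]}{[x_0-\mu_j+\gamma]}\prod_{\substack{j=1\\ j\ne i}}^L\frac{[x_i-x_j+\gamma]}{[x_i-x_j]}, \] \[ \bar{\mathcal N}_i=\frac{[\gamma][x_{\bar0}-x_i+\tau+(L+1)\gamma]}{[\tau+(L+1)\gamma][x_{\bar0}-x_i]}\prod_{j=1}^L[x_i-\mu_j]\prod_{\substack{j=1\\ j\ne i}}^L\frac{[x_i-x_j+\gamma]}{[x_i-x_j]}. \]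
   Context: Elliptic SOS setup. Fix $0<p<1$ and $\gamma\in\mathbb C$. For $x\in\mathbb C$ let $[x]:=\frac12\sum_{n\in\mathbb Z}(-1)^{n-\frac12}p^{(n+\frac12)^2}e^{-(2n+1)x}$ (the Jacobi theta function $\Theta_1(\mathrm i x,\nu)$, $p=e^{\mathrm i\pi\nu}$, in Whittaker–Watson conventions). Let $v_1,v_2$ be the standard basis of $\mathbb C^2$. The dynamical $R$-matrix $\mathcal R(x;\tau)\in\mathrm{End}(\mathbb C^2\otimes\mathbb C^2)$ is, in the ordered basis $v_1\otimes v_1, v_1\otimes v_2, v_2\otimes v_1, v_2\otimes v_2$, $\begin{pmatrix} a_+&0&0&0\\0&b_+&c_+&0\\0&c_-&b_-&0\\0&0&0&a_-\end{pmatrix}$ with $a_\pm=[x+\gamma]$, $b_\pm=[\tau\mp\gamma][x]/[\tau]$, $c_\pm=[\tau\mp x][\gamma]/[\tau]$. Fix $L\ge1$ and $\mu_1,\dots,\mu_L\in\mathbb C$. On $\mathbb C^2_0\otimes(\mathbb C^2)^{\otimes L}$ (auxiliary factor $0$, quantum factors $1,\dots,L$) let $h_k$ act on the $k$-th quantum factor by $h_kv_1=v_1$, $h_kv_2=-v_2$; $\mathcal R_{0i}(x;\tau-\gamma\sum_{k>i}h_k)$ denotes the operator acting on a tensor product of basis vectors whose $k$-th quantum factors have $h_k$-eigenvalues $\epsilon_k$ as $\mathcal R(x;\tau-\gamma\sum_{k>i}\epsilon_k)$ on factors $0,i$ and as identity elsewhere. The monodromy matrix is the ordered product $\mathcal T_0(x,\tau)=\mathcal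 R_{01}(x-\mu_1;\tau-\gamma\sum_{k=2}^Lh_k)\,\mathcal R_{02}(x-\mu_2;\tau-\gamma\sum_{k=3}^Lh_k)\cdots\mathcal R_{0L}(x-\mu_L;\tau)$, written as a $2\times2$ matrix in the auxiliary space (basis $v_1,v_2$) as $\begin{pmatrix}\mathcal A(x,\tau)&\mathcal B(x,\tau)\\ \mathcal C(x,\tau)&\mathcal D(x,\tau)\end{pmatrix}$ with entries in $\mathrm{End}((\mathbb C^2)^{\otimes L})$. Let $|0\rangle=v_1^{\otimes L}$ and $\langle\bar0|=(v_2^* )^{\otimes L}$ (dual basis covector). The partition function of the elliptic SOS model with domain-wall boundaries is $Z_\tau(x_1,\dots,x_L)=\langle\bar0|\mathcal B(x_1,\tau+\gamma)\mathcal B(x_2,\tau+2\gamma)\cdots\mathcal B(x_L,\tau+L\gamma)|0\rangle$. Notation: $X=(x_1,\dots,x_L)$; for an extra variable $x_\alpha$ and $1\le i\le L$, $X_i^\alpha$ is $X$ with $x_i$ replaced by $x_\alpha$. *)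

(* Defs.v *)
From Stdlib Require Import Reals List ZArith ClassicalEpsilon.
Import ListNotations.
Open Scope R_scope.

Definition Cplx : Type := (R * R)%type.
Definition RtoC (r : R) : Cplx := (r, 0).
Definition C0 : Cplx := (0, 0).
Definition C1 : Cplx := (1, 0).
Definition Cadd (z w : Cplx) : Cplx := (fst z + fst w, snd z + snd w).
Definition Copp (z : Cplx) : Cplx := (- fst z, - snd z).
Definition Csub (z w : Cplx) : Cplx := Cadd z (Copp w).
Definition Cmul (z w : Cplx) : Cplx :=
  (fst z * fst w - snd z * snd w, fst z * snd w + snd z * fst w).
Definition Cinv (z : Cplx) : Cplx :=
  (fst z / (fst z ^ 2 + snd z ^ 2), - snd z / (fst z ^ 2 + snd z ^ 2)).
Definition Cdiv (z w : Cplx) : Cplx := Cmul z (Cinv w).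
Definition Cexp (z : Cplx) : Cplx := (exp (fst z) * cos (snd z), exp (fst z) * sin (snd z)).

Definition Ccv (u : nat -> Cplx) (l : Cplx) : Prop :=
  Un_cv (fun n => fst (u n)) (fst l) /\ Un_cv (fun n => snd (u n)) (snd l).

Fixpoint Csum_nat (f : nat -> Cplx) (n : nat) : Cplx :=
  match n with O => C0 | S n' => Cadd (Csum_nat f n') (f n') end.
Definition Csum_1 (L : nat) (f : nat -> Cplx) : Cplx := Csum_nat (fun k => f (S k)) L.
Fixpoint Cprod_nat (f : nat -> Cplx) (n : nat) : Cplx :=
  match n with O => C1 | S n' => Cmul (Cprod_nat f n') (f n') end.
Definition Cprod_1 (L : nat) (f : nat -> Cplx) : Cplx := Cprod_nat (fun k => f (S k)) L.
Definition Cprod_1_ne (L i : nat) (f : nat -> Cplx) : Cplx :=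
  Cprod_1 L (fun j => if Nat.eqb j i then C1 else f j).
Definition Csum_list (l : list Cplx) : Cplx := fold_right Cadd C0 l.

(** * The theta function
    [x] = 1/2 sum_{n in Z} (-1)^(n-1/2) p^((n+1/2)^2) e^(-(2n+1)x),
    with (-1)^(n-1/2) := e^(i pi (n - 1/2)) and p^y := Rpower p y (p > 0). *)
Definition theta_term (p : R) (x : Cplx) (n : Z) : Cplx :=
  Cmul (Cexp (0, PI * (IZR n - 1/2)))
       (Cmul (RtoC (Rpower p ((IZR n + 1/2) ^ 2)))
             (Cexp (Cmul (RtoC (- (2 * IZR n + 1))) x))).

Definition theta_partial (p : R) (x : Cplx) (N : nat) : Cplx :=
  Csum_nat (fun k => theta_term p x (Z.of_nat k - Z.of_nat N)%Z) (2 * N + 1).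

Definition theta (p : R) (x : Cplx) : Cplx :=
  Cmul (RtoC (1/2)) (epsilon (inhabits C0) (fun l => Ccv (theta_partial p x) l)).

(** * The dynamical R-matrix.
    Rel p g x tau a' b' a b = matrix element of R(x;tau) from input v_a (x) v_b
    to output v_a' (x) v_b'; the boolean [true] encodes v_1 and [false] v_2. *)
Definition Rel (p : R) (g x tau : Cplx) (a' b' a b : bool) : Cplx :=
  let th := theta p in
  match a', b', a, b with
  | true, true, true, true => th (Cadd x g)
  | false, false, false, false => th (Cadd x g)
  | true, false, true, false => Cdiv (Cmul (th (Csub tau g)) (th x)) (th tau)
  | false, true, false, true => Cdiv (Cmul (th (Cadd tau g)) (th x)) (th tau)
  | true, false, false, true => Cdiv (Cmul (th (Csub tau x)) (th g)) (th tau)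
  | false, true, true, false => Cdiv (Cmul (th (Cadd tau x)) (th g)) (th tau)
  | _, _, _, _ => C0
  end.

Definition hval (b : bool) : R := if b then 1 else -1.
Definition hsum (l : list bool) : R := fold_right (fun b s => hval b + s) 0 l.

(** all basis states of (Cplx^2)^{(x) n}, as lists of length n *)
Fixpoint states (n : nat) : list (list bool) :=
  match n with
  | O => [[]]
  | S n' => flat_map (fun l => [true :: l; false :: l]) (states n')
  end.

(** Matrix element <a', e'| R_{0i} R_{0,i+1} ... R_{0L} |a, e> where e', e list the
    states of the quantum sites i, i+1, ..., L (output e', input e), and the
    dynamical argument of R_{0i} is tau - g * sum_{k>i} h_k evaluated on the
    state on which R_{0i} acts. *)
Fixpoint mono (p : R) (g : Cplx) (mu : nat -> Cplx) (x tau : Cplx) (i : nat)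
  (a' a : bool) (e' e : list bool) : Cplx :=
  match e', e with
  | [], [] => if Bool.eqb a' a then C1 else C0
  | b' :: r', b :: r =>
      Csum_list (map (fun c =>
         Cmul (Rel p g (Csub x (mu i)) (Csub tau (Cmul g (RtoC (hsum r')))) a' b' c b)
              (mono p g mu x tau (S i) c a r' r)) [true; false])
  | _, _ => C0
  end.

(** matrix element <e'| B(x,tau) |e> : auxiliary output v_1, input v_2 *)
Definition Bel (p : R) (g : Cplx) (L : nat) (mu : nat -> Cplx) (x tau : Cplx) (e' e : list bool) : Cplx :=
  mono p g mu x tau 1 true false e' e.

(** vectors of (Cplx^2)^{(x) L} as coefficient functions on basis states *)
Definition applyB (p : R) (g : Cplx) (L : nat) (mu : nat -> Cplx) (x tau : Cplx)
  (v : list bool -> Cplx) : list bool -> Cplx :=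
  fun e' => Csum_list (map (fun e => Cmul (Bel p g L mu x tau e' e) (v e)) (states L)).

Fixpoint prodB (p : R) (g : Cplx) (L : nat) (mu : nat -> Cplx) (tau : Cplx) (xs : nat -> Cplx)
  (k m : nat) (v : list bool -> Cplx) : list bool -> Cplx :=
  match m with
  | O => v
  | S m' => applyB p g L mu (xs k) (Cadd tau (Cmul (RtoC (INR k)) g))
              (prodB p g L mu tau xs (S k) m' v)
  end.

Definition vac (L : nat) : list bool -> Cplx :=
  fun e => if list_eq_dec Bool.bool_dec e (repeat true L) then C1 else C0.

Definition Zpf (p : R) (g : Cplx) (L : nat) (mu : nat -> Cplx) (tau : Cplx) (xs : nat -> Cplx) : Cplx :=
  prodB p g L mu tau xs 1 L (vac L) (repeat false L).

Definition replace_at (xs : nat -> Cplx) (i : nat) (xa : Cplx) : nat -> Cplx :=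
  fun j => if Nat.eqb j i then xa else xs j.

Definition M0 (p : R) (g : Cplx) (L : nat) (mu : nat -> Cplx) (x0 x0b : Cplx) (xs : nat -> Cplx) : Cplx :=
  let th := theta p in
  Csub (Cprod_1 L (fun j =>
          Cdiv (Cmul (Cmul (th (Cadd (Csub x0 (xs j)) g)) (th (Csub x0 (mu j))))
                     (th (Cadd (Csub x0b (mu j)) g)))
               (Cmul (th (Csub x0 (xs j))) (th (Cadd (Csub x0 (mu j)) g)))))
       (Cprod_1 L (fun j =>
          Cdiv (Cmul (th (Cadd (Csub x0b (xs j)) g)) (th (Csub x0b (mu j))))
               (th (Csub x0b (xs j))))).

Definition tauL (g : Cplx) (L : nat) (tau : Cplx) : Cplx := Cadd tau (Cmul (RtoC (INR (S L))) g).

Definition Ni (p : R) (g : Cplx) (L : nat) (mu : nat -> Cplx) (tau x0 x0b : Cplx) (xs : nat -> Cplx)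
  (i : nat) : Cplx :=
  let th := theta p in
  Copp (Cmul (Cmul
    (Cdiv (Cmul (th g) (th (Cadd (Csub x0 (xs i)) (tauL g L tau))))
          (Cmul (th (tauL g L tau)) (th (Csub x0 (xs i)))))
    (Cprod_1 L (fun j => Cdiv (Cmul (th (Csub (xs i) (mu j))) (th (Cadd (Csub x0b (mu j)) g)))
                              (th (Cadd (Csub x0 (mu j)) g)))))
    (Cprod_1_ne L i (fun j => Cdiv (th (Cadd (Csub (xs i) (xs j)) g)) (th (Csub (xs i) (xs j)))))).

Definition Nbi (p : R) (g : Cplx) (L : nat) (mu : nat -> Cplx) (tau x0b : Cplx) (xs : nat -> Cplx)
  (i : nat) : Cplx :=
  let th := theta p in
  Cmul (Cmul
    (Cdiv (Cmul (th g) (th (Cadd (Csub x0b (xs i)) (tauL g L tau))))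
          (Cmul (th (tauL g L tau)) (th (Csub x0b (xs i)))))
    (Cprod_1 L (fun j => th (Csub (xs i) (mu j)))))
    (Cprod_1_ne L i (fun j => Cdiv (th (Cadd (Csub (xs i) (xs j)) g)) (th (Csub (xs i) (xs j))))).

(* Main.v *)
(** Moving D(x; tau+g) through B(x_1; tau+2g) ... B(x_L; tau+(L+1)g) with the dynamical exchange
    relations, and evaluating D on the two extreme vectors, gives
      prod_j [x-x_j+g][x-mu_j]/[x-x_j] Z_tau(X) - sum_i c_i(x) Z_tau(X with x_i := x)
        = prod_j [x-mu_j+g] Z_(tau+g)(X),
    the dynamical factors [tau+2g]/[tau+(L+2)g] of the exchange and of the vacuum eigenvalue
    cancelling each other. Eliminating Z_(tau+g)(X) between x = x_0 and x = x_0bar is the theorem.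
    The exchange relations of B and D are proved by induction on the number of sites: once D B is
    eliminated in favour of B D, each step amounts to three-term relations for theta. *)

From Stdlib Require Import Reals List ZArith Lra Lia Permutation ClassicalEpsilon FinFun.
Require Import Defs.
Import ListNotations.
Open Scope R_scope.

(* The dynamical parameter is operator-valued. Fixing the output row [e] turns it into the number s
   = tau - g [hsum e]; since B and D change the weight by fixed amounts, every later parameter is a
   shift of s, so operator relations are stated row by row with scalar coefficients. B and D share
   the auxiliary input v_2, and their exchange relations close among themselves, so the right column
   of the monodromy matrix suffices. The three-term relation for theta comes from reindexing the
   double series of a product of two values, not from zeros and quasi-periods; hence the unordered
   sums. The coefficients c_i are found for all i at once: a recursion in the number of B operators
   is solved, and the symmetry of their product only identifies the two products reached when x_i
   leaves. The window 1-L <= m <= 2L in the theorem consists of the shifts tau + m g met when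
   neighbouring operators are exchanged. The cancelling factor [tau+(L+2)g] lies in it only for L >=
   2, which singles out L = 1. *)
Declare Scope cplx_scope.
Delimit Scope cplx_scope with cx.
Notation "z + w" := (Cadd z w) : cplx_scope.
Notation "z - w" := (Csub z w) : cplx_scope.
Notation "z * w" := (Cmul z w) : cplx_scope.
Notation "z / w" := (Cdiv z w) : cplx_scope.
Notation "- z" := (Copp z) : cplx_scope.

(** * Field structure and a norm on pairs of reals *)

Lemma Cplx_ring : ring_theory C0 C1 Cadd Cmul Csub Copp eq.
Proof.
  constructor; intros; unfold Cadd, Cmul, Csub, Copp, C0, C1, Cadd;
    apply injective_projections; simpl; ring.
Qed.

Lemma Cplx_norm_sq_neq_0 (z : Cplx) : z <> C0 -> fst z ^ 2 + snd z ^ 2 <> 0.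
Proof.
  intros Hz H. apply Hz. apply injective_projections; simpl; nra.
Qed.

Lemma Cplx_field : field_theory C0 C1 Cadd Cmul Csub Copp Cdiv Cinv eq.
Proof.
  constructor; [exact Cplx_ring | | reflexivity |].
  - intros H. apply (f_equal fst) in H. simpl in H. lra.
  - intros z Hz. apply Cplx_norm_sq_neq_0 in Hz.
    unfold Cmul, Cinv, C1. apply injective_projections; cbn [fst snd]; field; exact Hz.
Qed.

Add Field Cplx_field_inst : Cplx_field.

Lemma Cmul_eq_0 (z w : Cplx) : (z * w = C0 -> z = C0 \/ w = C0)%cx.
Proof.
  intros H. destruct (excluded_middle_informative (z = C0)) as [e|n]; [now left|right].
  replace w with (Cdiv (z * w) z)%cx by (field; exact n). rewrite H. field. exact n.
Qed.

Lemma Cmul_neq_0 (z w : Cplx) : z <> C0 -> w <> C0 -> (z * w)%cx <> C0.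
Proof. intros Hz Hw H. destruct (Cmul_eq_0 z w H); auto. Qed.

Lemma Cmul_cancel_l (c z w : Cplx) : c <> C0 -> (c * z = c * w)%cx -> z = w.
Proof.
  intros Hc H. replace z with (Cdiv (c * z) c)%cx by (field; exact Hc).
  rewrite H. field. exact Hc.
Qed.

Lemma Cdouble_inj (z w : Cplx) : (z + z = w + w)%cx -> z = w.
Proof.
  intros H. pose proof (f_equal fst H) as H1. pose proof (f_equal snd H) as H2.
  simpl in H1, H2. apply injective_projections; lra.
Qed.

(** The l1 norm: it dominates both components, and it is submultiplicative with constant 1. *)
Definition Cnorm1 (z : Cplx) : R := Rabs (fst z) + Rabs (snd z).

Lemma Cnorm1_pos z : 0 <= Cnorm1 z.
Proof. unfold Cnorm1. pose proof (Rabs_pos (fst z)). pose proof (Rabs_pos (snd z)). lra. Qed.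

Lemma Cnorm1_add z w : Cnorm1 (z + w)%cx <= Cnorm1 z + Cnorm1 w.
Proof.
  unfold Cnorm1, Cadd; simpl.
  pose proof (Rabs_triang (fst z) (fst w)). pose proof (Rabs_triang (snd z) (snd w)). lra.
Qed.

Lemma Cnorm1_opp z : Cnorm1 (- z)%cx = Cnorm1 z.
Proof. unfold Cnorm1, Copp; simpl. now rewrite !Rabs_Ropp. Qed.

Lemma Cnorm1_mul z w : Cnorm1 (z * w)%cx <= Cnorm1 z * Cnorm1 w.
Proof.
  unfold Cnorm1, Cmul; simpl. destruct z as [a b], w as [c d]; simpl.
  pose proof (Rabs_triang (a * c) (- (b * d))) as H1.
  pose proof (Rabs_triang (a * d) (b * c)) as H2.
  rewrite Rabs_Ropp in H1. rewrite !Rabs_mult in *. unfold Rminus. nra.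
Qed.

Lemma Cnorm1_small z : (forall e, 0 < e -> Cnorm1 z < e) -> z = C0.
Proof.
  intros H. destruct (Req_dec (Cnorm1 z) 0) as [e|n].
  - unfold Cnorm1 in e. pose proof (Rabs_pos (fst z)). pose proof (Rabs_pos (snd z)).
    apply injective_projections; simpl.
    + destruct (Req_dec (fst z) 0) as [|k]; auto. apply Rabs_pos_lt in k. lra.
    + destruct (Req_dec (snd z) 0) as [|k]; auto. apply Rabs_pos_lt in k. lra.
  - pose proof (Cnorm1_pos z). specialize (H (Cnorm1 z)). lra.
Qed.

Lemma Csub_small z w : (forall e, 0 < e -> Cnorm1 (z - w)%cx < e) -> z = w.
Proof.
  intros H. apply Cnorm1_small in H. replace z with (w + (z - w))%cx by ring.
  rewrite H. ring.
Qed.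

(** * Unordered summation *)

Definition Rsum {I : Type} (f : I -> R) (l : list I) : R := fold_right (fun i s => f i + s) 0 l.
Definition Csum {I : Type} (f : I -> Cplx) (l : list I) : Cplx :=
  fold_right (fun i s => Cadd (f i) s) C0 l.

(** Convergence along the net of finite subsets, encoded as duplicate-free lists. It does not depend
    on any order of the index set, so series can be reindexed, multiplied and split freely. *)
Definition has_sum {I : Type} (f : I -> Cplx) (s : Cplx) : Prop :=
  forall e, 0 < e -> exists l0, forall l, NoDup l -> incl l0 l -> Cnorm1 (Csum f l - s)%cx < e.
Definition summable {I : Type} (f : I -> Cplx) : Prop :=
  exists M, forall l, NoDup l -> Rsum (fun i => Cnorm1 (f i)) l <= M.

Lemma Rsum_app {I : Type} (f : I -> R) l1 l2 : Rsum f (l1 ++ l2) = Rsum f l1 + Rsum f l2.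
Proof. induction l1; simpl; [ring|]. rewrite IHl1. ring. Qed.

Lemma Csum_app {I : Type} (f : I -> Cplx) l1 l2 : Csum f (l1 ++ l2) = (Csum f l1 + Csum f l2)%cx.
Proof. induction l1; simpl; [ring|]. rewrite IHl1. ring. Qed.

Lemma Csum_map {I J : Type} (f : J -> Cplx) (h : I -> J) l :
  Csum f (map h l) = Csum (fun i => f (h i)) l.
Proof. induction l; simpl; congruence. Qed.

Lemma Csum_ext {I : Type} (f h : I -> Cplx) l :
  (forall i, In i l -> f i = h i) -> Csum f l = Csum h l.
Proof.
  induction l as [|a l IH]; intros H; simpl; [reflexivity|].
  rewrite (H a (or_introl eq_refl)), IH; [reflexivity|]. intros i Hi. apply H. now right.
Qed.

Lemma Csum_sub {I : Type} (f h : I -> Cplx) l :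
  Csum (fun i => f i - h i)%cx l = (Csum f l - Csum h l)%cx.
Proof. induction l; simpl; [ring|]. rewrite IHl. ring. Qed.

Lemma Csum_scal {I : Type} (c : Cplx) (f : I -> Cplx) l : Csum (fun i => c * f i)%cx l = (c * Csum f l)%cx.
Proof. induction l; simpl; [ring|]. rewrite IHl. ring. Qed.

Lemma Csum_prod {I J : Type} (f : I -> Cplx) (h : J -> Cplx) l1 l2 :
  Csum (fun k => f (fst k) * h (snd k))%cx (list_prod l1 l2) = (Csum f l1 * Csum h l2)%cx.
Proof.
  induction l1; simpl; [ring|].
  rewrite Csum_app, Csum_map, IHl1. cbn [fst snd]. rewrite Csum_scal. ring.
Qed.

Lemma Rsum_prod {I J : Type} (f : I -> R) (h : J -> R) l1 l2 :
  Rsum (fun k => f (fst k) * h (snd k)) (list_prod l1 l2) = Rsum f l1 * Rsum h l2.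
Proof.
  induction l1; simpl; [ring|].
  assert (H : forall l, Rsum (fun k : I * J => f (fst k) * h (snd k)) (map (fun y => (a, y)) l)
                        = f a * Rsum h l).
  { induction l; simpl; [ring|]. rewrite IHl. ring. }
  rewrite Rsum_app, H, IHl1. ring.
Qed.

Lemma Rsum_le {I : Type} (f h : I -> R) l : (forall i, f i <= h i) -> Rsum f l <= Rsum h l.
Proof. intros H. induction l; simpl; [lra|]. specialize (H a). lra. Qed.

Lemma Rsum_pos {I : Type} (f : I -> R) l : (forall i, 0 <= f i) -> 0 <= Rsum f l.
Proof. intros H. induction l; simpl; [lra|]. specialize (H a). lra. Qed.

Lemma Rsum_incl {I : Type} (f : I -> R) l l' :
  (forall i, 0 <= f i) -> NoDup l -> incl l l' -> Rsum f l <= Rsum f l'.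
Proof.
  intros Hf Hl. revert l'. induction Hl as [|a l Ha Hl IH]; intros l' Hi.
  - now apply Rsum_pos.
  - assert (Hin : In a l') by (apply Hi; now left).
    apply in_split in Hin. destruct Hin as (l1 & l2 & ->).
    rewrite Rsum_app. simpl.
    assert (H : Rsum f l <= Rsum f (l1 ++ l2)).
    { apply IH. intros b Hb. specialize (Hi b (or_intror Hb)).
      rewrite in_app_iff in *. simpl in Hi. destruct Hi as [|[->|]]; tauto. }
    rewrite Rsum_app in H. lra.
Qed.

Lemma exists_NoDup_incl {I : Type} (l : list I) : exists l', NoDup l' /\ incl l l'.
Proof.
  exists (nodup (fun a b => excluded_middle_informative (a = b)) l).
  split; [apply NoDup_nodup|]. intros a Ha. now apply nodup_In.
Qed.

(** Finite sums of nonnegative terms grow with the list, so the limit is their supremum. *)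
Lemma nonneg_unordered_sum {I : Type} (f : I -> R) M :
  (forall i, 0 <= f i) -> (forall l, NoDup l -> Rsum f l <= M) ->
  exists s, forall e, 0 < e -> exists l0, forall l, NoDup l -> incl l0 l -> Rabs (Rsum f l - s) < e.
Proof.
  intros Hf HM.
  destruct (completeness (fun r => exists l, NoDup l /\ r = Rsum f l)) as (s & Hub & Hlub).
  - exists M. intros r (l & Hl & ->). auto.
  - exists 0, []. split; [constructor|reflexivity].
  - exists s. intros e He.
    destruct (excluded_middle_informative (exists l, NoDup l /\ s - e < Rsum f l)) as [(l0 & H0 & H1)|n].
    + exists l0. intros l Hl Hi.
      assert (Rsum f l <= s) by (apply Hub; eauto).
      assert (Rsum f l0 <= Rsum f l) by (now apply Rsum_incl).
      apply Rabs_def1; lra.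
    + exfalso. assert (s <= s - e); [|lra]. apply Hlub. intros r (l & Hl & ->).
      destruct (Rle_dec (Rsum f l) (s - e)) as [|k]; auto. exfalso. apply n. exists l. split; auto; lra.
Qed.

(** The positive and negative parts are both dominated by the absolute value. *)
Lemma real_unordered_sum {I : Type} (f : I -> R) M :
  (forall l, NoDup l -> Rsum (fun i => Rabs (f i)) l <= M) ->
  exists s, forall e, 0 < e -> exists l0, forall l, NoDup l -> incl l0 l -> Rabs (Rsum f l - s) < e.
Proof.
  intros HM.
  assert (H : forall u : I -> R, (forall i, 0 <= u i <= Rabs (f i)) ->
    exists s, forall e, 0 < e -> exists l0, forall l, NoDup l -> incl l0 l -> Rabs (Rsum u l - s) < e).
  { intros u Hu. apply nonneg_unordered_sum with M; [apply Hu|].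
    intros l Hl. apply Rle_trans with (2 := HM l Hl). apply Rsum_le. apply Hu. }
  destruct (H (fun i => Rmax (f i) 0)) as (s1 & H1).
  { intros i. unfold Rmax, Rabs. destruct (Rle_dec (f i) 0), (Rcase_abs (f i)); lra. }
  destruct (H (fun i => Rmax (- f i) 0)) as (s2 & H2).
  { intros i. unfold Rmax, Rabs. destruct (Rle_dec (- f i) 0), (Rcase_abs (f i)); lra. }
  exists (s1 - s2). intros e He.
  destruct (H1 (e / 2)) as (l1 & K1); [lra|]. destruct (H2 (e / 2)) as (l2 & K2); [lra|].
  exists (l1 ++ l2). intros l Hl Hi. apply incl_app_inv in Hi.
  specialize (K1 l Hl (proj1 Hi)). specialize (K2 l Hl (proj2 Hi)).
  assert (E : Rsum f l = Rsum (fun i => Rmax (f i) 0) l - Rsum (fun i => Rmax (- f i) 0) l).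
  { clear. induction l; simpl; [ring|]. rewrite IHl.
    unfold Rmax. destruct (Rle_dec (f a) 0), (Rle_dec (- f a) 0); lra. }
  rewrite E. apply Rabs_def2 in K1. apply Rabs_def2 in K2. apply Rabs_def1; lra.
Qed.

Lemma fst_Csum {I : Type} (f : I -> Cplx) l : fst (Csum f l) = Rsum (fun i => fst (f i)) l.
Proof. induction l; simpl; congruence. Qed.

Lemma snd_Csum {I : Type} (f : I -> Cplx) l : snd (Csum f l) = Rsum (fun i => snd (f i)) l.
Proof. induction l; simpl; congruence. Qed.

Lemma summable_has_sum {I : Type} (f : I -> Cplx) : summable f -> exists s, has_sum f s.
Proof.
  intros (M & HM).
  destruct (real_unordered_sum (fun i => fst (f i)) M) as (s1 & H1).
  { intros l Hl. apply Rle_trans with (2 := HM l Hl). apply Rsum_le. intros i.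
    unfold Cnorm1. pose proof (Rabs_pos (snd (f i))). lra. }
  destruct (real_unordered_sum (fun i => snd (f i)) M) as (s2 & H2).
  { intros l Hl. apply Rle_trans with (2 := HM l Hl). apply Rsum_le. intros i.
    unfold Cnorm1. pose proof (Rabs_pos (fst (f i))). lra. }
  exists (s1, s2). intros e He.
  destruct (H1 (e / 2)) as (l1 & K1); [lra|]. destruct (H2 (e / 2)) as (l2 & K2); [lra|].
  exists (l1 ++ l2). intros l Hl Hi. apply incl_app_inv in Hi.
  specialize (K1 l Hl (proj1 Hi)). specialize (K2 l Hl (proj2 Hi)).
  unfold Cnorm1, Csub, Cadd, Copp; cbn [fst snd]. rewrite fst_Csum, snd_Csum.
  unfold Rminus in *. lra.
Qed.

(** Once a sum is known to exist, its value can be read off along any cofinal family of lists. This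
    allows lists of a convenient shape: rectangles for products, unions of two images for
    splittings. *)
Lemma has_sum_eq {I : Type} (f : I -> Cplx) s t :
  has_sum f s ->
  (forall e l0, 0 < e -> exists l, NoDup l /\ incl l0 l /\ Cnorm1 (Csum f l - t)%cx < e) -> s = t.
Proof.
  intros Hs Ht. apply Csub_small. intros e He.
  destruct (Hs (e / 2)) as (l0 & H0); [lra|].
  destruct (Ht (e / 2) l0) as (l & Hl & Hi & H1); [lra|]. specialize (H0 l Hl Hi).
  replace (s - t)%cx with (Csum f l - t + - (Csum f l - s))%cx by ring.
  eapply Rle_lt_trans; [apply Cnorm1_add|]. rewrite Cnorm1_opp. lra.
Qed.

Lemma has_sum_close {I : Type} (f : I -> Cplx) s e l0 :
  has_sum f s -> 0 < e -> exists l, NoDup l /\ incl l0 l /\ Cnorm1 (Csum f l - s)%cx < e.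
Proof.
  intros Hs He. destruct (Hs e He) as (l1 & H1).
  destruct (exists_NoDup_incl (l0 ++ l1)) as (l & Hl & Hi). apply incl_app_inv in Hi.
  exists l. split; [|split]; auto; [apply Hi|]. apply H1; auto. apply Hi.
Qed.

Lemma has_sum_unique {I : Type} (f : I -> Cplx) s t : has_sum f s -> has_sum f t -> s = t.
Proof.
  intros Hs Ht. apply (has_sum_eq f s t Hs). intros e l0 He. now apply has_sum_close.
Qed.

Lemma has_sum_ext {I : Type} (f h : I -> Cplx) s : (forall i, f i = h i) -> has_sum f s -> has_sum h s.
Proof.
  intros E H e He. destruct (H e He) as (l0 & H0). exists l0. intros l Hl Hi.
  rewrite <- (Csum_ext f h l (fun i _ => E i)). auto.
Qed.

Lemma has_sum_scal {I : Type} (f : I -> Cplx) c s : has_sum f s -> has_sum (fun i => c * f i)%cx (c * s)%cx.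
Proof.
  intros H e He. pose proof (Cnorm1_pos c).
  destruct (H (e / (Cnorm1 c + 1))) as (l0 & K).
  { apply Rdiv_lt_0_compat; lra. }
  exists l0. intros l Hl Hi. specialize (K l Hl Hi). rewrite Csum_scal.
  replace (c * Csum f l - c * s)%cx with (c * (Csum f l - s))%cx by ring.
  eapply Rle_lt_trans; [apply Cnorm1_mul|].
  apply Rle_lt_trans with ((Cnorm1 c + 1) * Cnorm1 (Csum f l - s)%cx).
  - pose proof (Cnorm1_pos (Csum f l - s)%cx). nra.
  - apply Rmult_lt_reg_r with (/ (Cnorm1 c + 1)); [apply Rinv_0_lt_compat; lra|].
    replace ((Cnorm1 c + 1) * Cnorm1 (Csum f l - s)%cx * / (Cnorm1 c + 1))
      with (Cnorm1 (Csum f l - s)%cx) by (field; lra). exact K.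
Qed.

Lemma has_sum_involution {I : Type} (f : I -> Cplx) (h : I -> I) s :
  (forall i, h (h i) = i) -> has_sum f s -> has_sum (fun i => f (h i)) s.
Proof.
  intros Hh H e He. destruct (H e He) as (l0 & H0). exists (map h l0). intros l Hl Hi.
  rewrite <- Csum_map. apply H0.
  - apply Injective_map_NoDup; auto. intros a b E. rewrite <- (Hh a), <- (Hh b). congruence.
  - intros a Ha. rewrite <- (Hh a). apply in_map. apply Hi. now apply in_map.
Qed.

Lemma summable_prod {I J : Type} (f : I -> Cplx) (h : J -> Cplx) :
  summable f -> summable h -> summable (fun k : I * J => f (fst k) * h (snd k))%cx.
Proof.
  intros (M & HM) (N & HN). exists (M * N). intros l Hl.
  destruct (exists_NoDup_incl (map fst l)) as (l1 & H1 & I1).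
  destruct (exists_NoDup_incl (map snd l)) as (l2 & H2 & I2).
  apply Rle_trans with (Rsum (fun k => Cnorm1 (f (fst k)) * Cnorm1 (h (snd k))) l).
  { apply Rsum_le. intros k. apply Cnorm1_mul. }
  apply Rle_trans with (Rsum (fun k => Cnorm1 (f (fst k)) * Cnorm1 (h (snd k))) (list_prod l1 l2)).
  - apply Rsum_incl; auto.
    + intros k. apply Rmult_le_pos; apply Cnorm1_pos.
    + intros [a b] Hab. apply in_prod.
      * apply I1. change a with (fst (a, b)). now apply in_map.
      * apply I2. change b with (snd (a, b)). now apply in_map.
  - rewrite (Rsum_prod (fun i => Cnorm1 (f i)) (fun j => Cnorm1 (h j))).
    apply Rmult_le_compat; auto; apply Rsum_pos; intros; apply Cnorm1_pos.
Qed.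

Lemma NoDup_list_prod {I J : Type} (l1 : list I) (l2 : list J) :
  NoDup l1 -> NoDup l2 -> NoDup (list_prod l1 l2).
Proof.
  intros H1 H2. induction H1 as [|a l1 Ha H1 IH]; simpl; [constructor|].
  apply NoDup_app; auto.
  - apply Injective_map_NoDup; auto. intros b b' E. now injection E.
  - intros k Hk Hk'. apply in_map_iff in Hk. destruct Hk as (b & <- & _).
    apply in_prod_iff in Hk'. tauto.
Qed.

(** Absolute summability gives the existence of the double sum; rectangles give its value. *)
Lemma has_sum_prod {I J : Type} (f : I -> Cplx) (h : J -> Cplx) s t :
  summable f -> summable h -> has_sum f s -> has_sum h t ->
  has_sum (fun k : I * J => f (fst k) * h (snd k))%cx (s * t)%cx.
Proof.
  intros Sf Sh Hf Hh. destruct (summable_has_sum _ (summable_prod f h Sf Sh)) as (u & Hu).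
  replace (s * t)%cx with u; [exact Hu|]. apply (has_sum_eq _ _ _ Hu). intros e l0 He.
  pose proof (Cnorm1_pos s). pose proof (Cnorm1_pos t).
  (* The error (A-s)(B-t) + (A-s)t + s(B-t) is at most d^2 + d(|s|+|t|), and d <= 1 bounds d^2 by
     d. *)
  set (d := Rmin 1 (e / (Cnorm1 s + Cnorm1 t + 2))).
  assert (Hd : 0 < d).
  { unfold d. apply Rmin_glb_lt; [lra|]. apply Rdiv_lt_0_compat; lra. }
  assert (Hd1 : d <= 1) by apply Rmin_l.
  assert (Hd2 : d * (Cnorm1 s + Cnorm1 t + 2) <= e).
  { apply Rmult_le_reg_r with (/ (Cnorm1 s + Cnorm1 t + 2)); [apply Rinv_0_lt_compat; lra|].
    replace (d * (Cnorm1 s + Cnorm1 t + 2) * / (Cnorm1 s + Cnorm1 t + 2)) with d by (field; lra).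
    apply Rmin_r. }
  destruct (has_sum_close f s d (map fst l0) Hf Hd) as (l1 & N1 & I1 & E1).
  destruct (has_sum_close h t d (map snd l0) Hh Hd) as (l2 & N2 & I2 & E2).
  exists (list_prod l1 l2). split; [now apply NoDup_list_prod|]. split.
  - intros [a b] Hab. apply in_prod.
    + apply I1. change a with (fst (a, b)). now apply in_map.
    + apply I2. change b with (snd (a, b)). now apply in_map.
  - rewrite Csum_prod. set (A := Csum f l1) in *. set (B := Csum h l2) in *.
    replace (A * B - s * t)%cx with ((A - s) * (B - t) + ((A - s) * t + s * (B - t)))%cx by ring.
    eapply Rle_lt_trans; [apply Cnorm1_add|].
    pose proof (Cnorm1_add ((A - s) * t) (s * (B - t)))%cx.
    pose proof (Cnorm1_mul (A - s) (B - t))%cx.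
    pose proof (Cnorm1_mul (A - s) t)%cx. pose proof (Cnorm1_mul s (B - t))%cx.
    pose proof (Cnorm1_pos (A - s)%cx). pose proof (Cnorm1_pos (B - t)%cx).
    nra.
Qed.

Lemma has_sum_split {I J K : Type} (f : I -> Cplx) (phi : J -> I) (psi : K -> I) s t u :
  Injective phi -> Injective psi -> (forall j k, phi j <> psi k) ->
  (forall i, (exists j, i = phi j) \/ (exists k, i = psi k)) ->
  has_sum f u -> has_sum (fun j => f (phi j)) s -> has_sum (fun k => f (psi k)) t ->
  u = (s + t)%cx.
Proof.
  intros Hphi Hpsi Hd Hc Hu Hs Ht. apply (has_sum_eq f u _ Hu). intros e l0 He.
  assert (HL : exists l1 l2, incl l0 (map phi l1 ++ map psi l2)).
  { clear - Hc. induction l0 as [|i l0 (l1 & l2 & IH)].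
    - exists [], []. intros i [].
    - destruct (Hc i) as [(j & ->)|(k & ->)].
      + exists (j :: l1), l2. intros a [<-|Ha]; [now left|right; now apply IH].
      + exists l1, (k :: l2). intros a [<-|Ha].
        * apply in_or_app. right. now left.
        * specialize (IH a Ha). apply in_app_or in IH. apply in_or_app. simpl. tauto. }
  destruct HL as (l1 & l2 & HL).
  destruct (has_sum_close _ s (e / 2) l1 Hs) as (m1 & N1 & I1 & E1); [lra|].
  destruct (has_sum_close _ t (e / 2) l2 Ht) as (m2 & N2 & I2 & E2); [lra|].
  exists (map phi m1 ++ map psi m2). split; [|split].
  - apply NoDup_app; try (apply Injective_map_NoDup; assumption).
    intros a Ha Hb. apply in_map_iff in Ha. apply in_map_iff in Hb.
    destruct Ha as (j & <- & _). destruct Hb as (k & E & _). now apply (Hd j k).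
  - intros a Ha. specialize (HL a Ha). rewrite in_app_iff, !in_map_iff in *.
    destruct HL as [(j & E & Hj)|(k & E & Hk)]; [left; exists j|right; exists k]; auto.
  - rewrite Csum_app, !Csum_map.
    set (A := Csum _ m1) in *. set (B := Csum _ m2) in *.
    replace (A + B - (s + t))%cx with ((A - s) + (B - t))%cx by ring.
    eapply Rle_lt_trans; [apply Cnorm1_add|]. lra.
Qed.

(** * The theta function *)

Lemma Cexp_add z w : Cexp (z + w)%cx = (Cexp z * Cexp w)%cx.
Proof.
  unfold Cexp, Cadd, Cmul. cbn [fst snd]. rewrite exp_plus, cos_plus, sin_plus.
  apply injective_projections; cbn [fst snd]; ring.
Qed.

Lemma Cexp_RtoC r : Cexp (RtoC r) = RtoC (exp r).
Proof.
  unfold Cexp, RtoC. cbn [fst snd]. rewrite cos_0, sin_0.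
  apply injective_projections; cbn [fst snd]; ring.
Qed.

Lemma Cexp_2PI_nat (k : nat) : Cexp (0, 2 * INR k * PI) = C1.
Proof.
  unfold Cexp. cbn [fst snd]. rewrite exp_0.
  rewrite <- (Rplus_0_l (2 * INR k * PI)), cos_period, sin_period, cos_0, sin_0.
  apply injective_projections; simpl; ring.
Qed.

Lemma Cexp_2PI (k : Z) : Cexp (0, 2 * IZR k * PI) = C1.
Proof.
  destruct (Z_le_gt_dec 0 k) as [H|H].
  - rewrite <- (Z2Nat.id k), <- INR_IZR_INZ by exact H. apply Cexp_2PI_nat.
  - pose proof (Cexp_2PI_nat (Z.to_nat (- k))) as E.
    rewrite INR_IZR_INZ, Z2Nat.id, opp_IZR in E by lia.
    assert (A : (Cexp (0, 2 * IZR k * PI)%R * Cexp (0, 2 * - IZR k * PI)%R = C1)%cx).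
    { rewrite <- Cexp_add. unfold Cadd. cbn [fst snd].
      replace (0 + 0, 2 * IZR k * PI + 2 * - IZR k * PI) with (RtoC 0)
        by (unfold RtoC; f_equal; ring).
      rewrite Cexp_RtoC, exp_0. reflexivity. }
    rewrite E in A. rewrite <- A. ring.
Qed.

Lemma Cexp_PI : Cexp (0, PI) = (- C1)%cx.
Proof.
  unfold Cexp. cbn [fst snd]. rewrite exp_0, cos_PI, sin_PI.
  apply injective_projections; simpl; ring.
Qed.

Lemma Cnorm1_Cexp z : Cnorm1 (Cexp z) <= 2 * exp (fst z).
Proof.
  unfold Cnorm1, Cexp. cbn [fst snd]. rewrite !Rabs_mult.
  pose proof (exp_pos (fst z)). rewrite (Rabs_pos_eq (exp (fst z))) by lra.
  assert (Rabs (cos (snd z)) <= 1) by (apply Rabs_le; apply COS_bound).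
  assert (Rabs (sin (snd z)) <= 1) by (apply Rabs_le; apply SIN_bound).
  nra.
Qed.

Lemma Cmul_C1_l z : (C1 * z)%cx = z.
Proof. ring. Qed.

Fixpoint Zball (N : nat) : list Z :=
  match N with
  | O => [0%Z]
  | S N' => Z.of_nat N :: (- Z.of_nat N)%Z :: Zball N'
  end.

Lemma in_Zball N n : In n (Zball N) <-> (Z.abs n <= Z.of_nat N)%Z.
Proof.
  induction N as [|N IH]; simpl In; [lia|]. rewrite IH. lia.
Qed.

Lemma in_Zball_bounded (l : list Z) : exists N, incl l (Zball N).
Proof.
  induction l as [|n l (N & IH)].
  - exists O. intros n [].
  - exists (Z.to_nat (Z.abs n) + N)%nat. intros m [<-|Hm]; apply in_Zball.
    + lia.
    + specialize (IH m Hm). apply in_Zball in IH. lia.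
Qed.

(** The subtracted term makes the induction close: exp(-N) >= 2 exp(-(N+1)), because e >= 2. *)
Lemma Rsum_exp_abs N : Rsum (fun n => exp (- IZR (Z.abs n))) (Zball N) <= 3 - 2 * exp (- INR N).
Proof.
  induction N as [|N IH].
  - simpl. rewrite Ropp_0, exp_0. lra.
  - cbn [Zball Rsum fold_right]. fold (Rsum (fun n => exp (- IZR (Z.abs n))) (Zball N)).
    rewrite Z.abs_opp, Z.abs_eq, <- INR_IZR_INZ by lia.
    assert (exp (- INR N) >= 2 * exp (- INR (S N))).
    { rewrite S_INR. replace (- INR N) with (1 + - (INR N + 1)) by ring. rewrite exp_plus.
      pose proof (exp_ineq1 1). pose proof (exp_pos (- (INR N + 1))). nra. }
    lra.
Qed.

(** Completing the square bounds -q u^2 + (|b|+1) u by (|b|+1)^2/(4q) for u = |n|, which leaves a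
    constant times exp(-|n|). *)
Lemma gaussian_summable (f : Z -> Cplx) (q b c : R) :
  0 < q -> (forall n, Cnorm1 (f n) <= 2 * exp (- q * IZR n ^ 2 + b * IZR n + c)) -> summable f.
Proof.
  intros Hq Hf. set (K := c + (Rabs b + 1) ^ 2 / (4 * q)).
  assert (H : forall n, Cnorm1 (f n) <= 2 * exp K * exp (- IZR (Z.abs n))).
  { intros n. eapply Rle_trans; [apply Hf|]. rewrite Rmult_assoc, <- exp_plus.
    apply Rmult_le_compat_l; [lra|].
    assert (E : - q * IZR n ^ 2 + b * IZR n + c <= K + - IZR (Z.abs n)).
    { rewrite abs_IZR. set (u := Rabs (IZR n)).
      assert (Hu : IZR n ^ 2 = u ^ 2) by (unfold u; now rewrite pow2_abs).
      assert (Hb : b * IZR n <= Rabs b * u) by (unfold u; rewrite <- Rabs_mult; apply Rle_abs).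
      assert (S : K - c - (Rabs b + 1) * u + q * u ^ 2
                  = (2 * q * u - (Rabs b + 1)) ^ 2 / (4 * q)) by (unfold K; field; lra).
      assert (0 <= K - c - (Rabs b + 1) * u + q * u ^ 2).
      { rewrite S. apply Rmult_le_pos; [apply pow2_ge_0|]. left. apply Rinv_0_lt_compat. lra. }
      rewrite Hu. lra. }
    destruct E as [E|E]; [left; now apply exp_increasing|right; now rewrite E]. }
  exists (2 * exp K * 3). intros l Hl. destruct (in_Zball_bounded l) as (N & HN).
  apply Rle_trans with (Rsum (fun n => Cnorm1 (f n)) (Zball N)).
  { apply Rsum_incl; auto. intros n. apply Cnorm1_pos. }
  apply Rle_trans with (Rsum (fun n => 2 * exp K * exp (- IZR (Z.abs n))) (Zball N)).
  { now apply Rsum_le. }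
  assert (E : forall m, Rsum (fun n => 2 * exp K * exp (- IZR (Z.abs n))) m =
              2 * exp K * Rsum (fun n => exp (- IZR (Z.abs n))) m).
  { induction m; simpl; [ring|]. rewrite IHm. ring. }
  rewrite E. pose proof (Rsum_exp_abs N). pose proof (exp_pos (- INR N)). pose proof (exp_pos K).
  apply Rmult_le_compat_l; lra.
Qed.

(** Sign, Gaussian and exponential are merged into one exponent, so that identities between terms
    become identities between exponents up to multiples of 2 pi i. *)
Definition theta_exponent (p : R) (x : Cplx) (n : Z) : Cplx :=
  ((0, PI * (IZR n - 1/2))%R + (RtoC ((IZR n + 1/2) ^ 2 * ln p)%R + RtoC (- (2 * IZR n + 1))%R * x))%cx.

Lemma theta_term_Cexp p x n : theta_term p x n = Cexp (theta_exponent p x n).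
Proof.
  unfold theta_term, theta_exponent. rewrite !Cexp_add, Cexp_RtoC. reflexivity.
Qed.

Lemma Csum_nat_Csum (f : nat -> Cplx) n : Csum_nat f n = Csum f (seq 0 n).
Proof.
  induction n; [reflexivity|]. rewrite seq_S, Csum_app. simpl. rewrite IHn. ring.
Qed.

Section Theta.
Variables (p : R) (Hp : 0 < p < 1).

Lemma ln_neg : ln p < 0.
Proof using Hp. rewrite <- ln_1. now apply ln_increasing. Qed.

Lemma theta_summable x : summable (theta_term p x).
Proof using Hp.
  apply (gaussian_summable _ (- ln p) (ln p - 2 * fst x) (ln p / 4 - fst x)).
  - pose proof ln_neg. lra.
  - intros n. rewrite theta_term_Cexp. eapply Rle_trans; [apply Cnorm1_Cexp|].
    right. do 2 f_equal. unfold theta_exponent, Cadd, Cmul, RtoC. cbn [fst snd]. field.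
Qed.

Lemma theta_partial_cv x s : has_sum (theta_term p x) s -> Ccv (theta_partial p x) s.
Proof using.
  intros H.
  assert (K : forall e, 0 < e -> exists N, forall n, (n >= N)%nat -> Cnorm1 (theta_partial p x n - s)%cx < e).
  { intros e He. destruct (H e He) as (l0 & H0). destruct (in_Zball_bounded l0) as (N & HN).
    exists N. intros n Hn. unfold theta_partial. rewrite Csum_nat_Csum.
    rewrite <- (Csum_map (theta_term p x) (fun k => Z.of_nat k - Z.of_nat n)%Z). apply H0.
    - apply Injective_map_NoDup; [|apply seq_NoDup]. intros a b. lia.
    - intros m Hm. specialize (HN m Hm). apply in_Zball in HN.
      apply in_map_iff. exists (Z.to_nat (m + Z.of_nat n)). rewrite in_seq. lia. }
  assert (P : forall z w : Cplx, Rabs (fst z - fst w) <= Cnorm1 (z - w)%cx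
                                 /\ Rabs (snd z - snd w) <= Cnorm1 (z - w)%cx).
  { intros z w. unfold Cnorm1, Csub, Cadd, Copp; cbn [fst snd]. fold (fst z - fst w) (snd z - snd w).
    pose proof (Rabs_pos (fst z - fst w)). pose proof (Rabs_pos (snd z - snd w)). lra. }
  split; intros e He; destruct (K e He) as (N & HN); exists N; intros n Hn; specialize (HN n Hn);
    destruct (P (theta_partial p x n) s); unfold Rdist; lra.
Qed.

(** The series sums to twice [theta] because of the prefactor 1/2; the value chosen by [epsilon] is
    the actual sum by uniqueness of limits. *)
Lemma theta_has_sum x : has_sum (theta_term p x) (theta p x + theta p x)%cx.
Proof using Hp.
  destruct (summable_has_sum _ (theta_summable x)) as (s & Hs).
  pose proof (theta_partial_cv x s Hs) as Hcv.
  assert (E : epsilon (inhabits C0) (fun l => Ccv (theta_partial p x) l) = s).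
  { assert (S : Ccv (theta_partial p x) (epsilon (inhabits C0) (fun l => Ccv (theta_partial p x) l)))
      by (apply epsilon_spec; now exists s).
    destruct S as [S1 S2], Hcv as [T1 T2].
    apply injective_projections; eapply UL_sequence; eassumption. }
  unfold theta. rewrite E.
  replace (RtoC (1/2)%R * s + RtoC (1/2)%R * s)%cx with s; [exact Hs|].
  unfold RtoC, Cadd, Cmul. apply injective_projections; cbn [fst snd]; field.
Qed.

(** The involution n -> -n-1 fixes (n+1/2)^2, negates 2n+1 and flips the sign of the term. *)
Lemma theta_opp x : theta p (- x)%cx = (- theta p x)%cx.
Proof using Hp.
  apply Cdouble_inj.
  replace (- theta p x + - theta p x)%cx with ((- C1) * (theta p x + theta p x))%cx by ring.
  apply has_sum_unique with (theta_term p (- x)%cx); [apply theta_has_sum|].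
  apply has_sum_ext with (fun n => (- C1) * theta_term p x (- n - 1)%Z)%cx.
  - intros n. rewrite !theta_term_Cexp, <- Cexp_PI.
    transitivity (Cexp ((0, PI) + theta_exponent p x (- n - 1)) * Cexp (0, 2 * IZR n * PI)%R)%cx.
    { rewrite Cexp_2PI, Cexp_add. ring. }
    rewrite <- Cexp_add. f_equal. unfold theta_exponent, Cadd, Cmul, Copp, RtoC.
    rewrite minus_IZR, opp_IZR. apply injective_projections; cbn [fst snd]; field.
  - apply has_sum_scal. apply (has_sum_involution _ (fun n => - n - 1)%Z); [lia|].
    apply theta_has_sum.
Qed.

(** The terms of the Jacobi functions Theta_3 and, for [theta_odd], Theta_2, both at 2ix with nome
    p^2. *)
Definition theta_even (x : Cplx) (k : Z) : Cplx :=
  Cexp (RtoC (2 * IZR k ^ 2 * ln p)%R + RtoC (- (4 * IZR k))%R * x)%cx.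
Definition theta_odd (x : Cplx) (k : Z) : Cplx :=
  Cexp (RtoC ((2 * IZR k + 1) ^ 2 / 2 * ln p)%R + RtoC (- (4 * IZR k + 2))%R * x)%cx.

Lemma theta_even_summable x : summable (theta_even x).
Proof using Hp.
  apply (gaussian_summable _ (- (2 * ln p)) (- 4 * fst x) 0).
  - pose proof ln_neg. lra.
  - intros n. eapply Rle_trans; [apply Cnorm1_Cexp|].
    right. do 2 f_equal. unfold Cadd, Cmul, RtoC. cbn [fst snd]. field.
Qed.

Lemma theta_odd_summable x : summable (theta_odd x).
Proof using Hp.
  apply (gaussian_summable _ (- (2 * ln p)) (2 * ln p - 4 * fst x) (ln p / 2 - 2 * fst x)).
  - pose proof ln_neg. lra.
  - intros n. eapply Rle_trans; [apply Cnorm1_Cexp|].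
    right. do 2 f_equal. unfold Cadd, Cmul, RtoC. cbn [fst snd]. field.
Qed.

(* In the double series for [x+y][x-y], the indices a = n+m+1 and b = n-m
   have opposite parities and separate x from y. *)
Lemma theta_add_sub : exists E O : Cplx -> Cplx, forall x y,
  (theta p (x + y) * theta p (x - y) = E x * O y - O x * E y)%cx.
Proof using Hp.
  set (E := fun x => epsilon (inhabits C0) (has_sum (theta_even x))).
  set (O := fun x => epsilon (inhabits C0) (has_sum (theta_odd x))).
  assert (HE : forall x, has_sum (theta_even x) (E x))
    by (intros x; apply epsilon_spec, summable_has_sum, theta_even_summable).
  assert (HO : forall x, has_sum (theta_odd x) (O x))
    by (intros x; apply epsilon_spec, summable_has_sum, theta_odd_summable).
  exists (fun x => RtoC (1/2)%R * E x)%cx, (fun x => RtoC (1/2)%R * O x)%cx. intros x y.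
  set (A := theta p (x + y)%cx). set (B := theta p (x - y)%cx).
  assert (H : ((A + A) * (B + B) = E x * O y + (- C1) * (O x * E y))%cx).
  { set (f := fun k : Z * Z => (theta_term p (x + y) (fst k) * theta_term p (x - y) (snd k))%cx).
    (* The first map has a = 2k, b = 2l+1 and covers n+m odd; the second has a = 2k+1, b = 2l and
       covers n+m even. *)
    apply (has_sum_split f (fun k => (fst k + snd k, fst k - snd k - 1)%Z)
                           (fun k => (fst k + snd k, fst k - snd k)%Z)).
    - intros [a b] [c d] H. cbn [fst snd] in H. injection H. intros. f_equal; lia.
    - intros [a b] [c d] H. cbn [fst snd] in H. injection H. intros. f_equal; lia.
    - intros [a b] [c d] H. cbn [fst snd] in H. injection H. lia.
    - intros [n m]. destruct (Z.Even_or_Odd (n + m)) as [[k Hk]|[k Hk]].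
      + right. exists (k, n - k)%Z. cbn [fst snd]. f_equal; lia.
      + left. exists (k + 1, n - k - 1)%Z. cbn [fst snd]. f_equal; lia.
    - apply has_sum_prod; auto using theta_summable, theta_has_sum.
    - apply has_sum_ext with (fun k : Z * Z => theta_even x (fst k) * theta_odd y (snd k))%cx.
      + intros [k l]. unfold f, theta_even, theta_odd. cbn [fst snd].
        rewrite !theta_term_Cexp, <- !Cexp_add.
        (* The two phases add up to pi(n+m-1), which is 2 pi (k-1) here; in the second family it is
           2 pi (k-1) + pi, whence the factor -1. *)
        rewrite <- (Cmul_C1_l (Cexp _)), <- (Cexp_2PI (k - 1)), <- Cexp_add. f_equal.
        unfold theta_exponent, Cadd, Cmul, Copp, Csub, RtoC, Cadd, Copp.
        rewrite ?minus_IZR, ?plus_IZR. apply injective_projections; cbn [fst snd]; field.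
      + apply has_sum_prod; auto using theta_even_summable, theta_odd_summable.
    - apply has_sum_ext with
        (fun k : Z * Z => (- C1) * (theta_odd x (fst k) * theta_even y (snd k)))%cx.
      + intros [k l]. unfold f, theta_even, theta_odd. cbn [fst snd].
        rewrite !theta_term_Cexp, <- !Cexp_add, <- Cexp_PI, <- Cexp_add.
        rewrite <- (Cmul_C1_l (Cexp _)), <- (Cexp_2PI (k - 1)), <- Cexp_add. f_equal.
        unfold theta_exponent, Cadd, Cmul, Copp, Csub, RtoC, Cadd, Copp.
        rewrite ?minus_IZR, ?plus_IZR. apply injective_projections; cbn [fst snd]; field.
      + apply has_sum_scal.
        apply has_sum_prod; auto using theta_even_summable, theta_odd_summable. }
  set (h := RtoC (1/2)%R). assert (Hh : (h + h = C1)%cx).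
  { unfold h, RtoC, Cadd. apply injective_projections; cbn [fst snd]; simpl; field. }
  transitivity (h * h * ((A + A) * (B + B)))%cx.
  - transitivity ((h + h) * (h + h) * (A * B))%cx; [rewrite Hh; ring|ring].
  - rewrite H. ring.
Qed.

(* The three-term relation is the Pluecker relation for the 2-vectors (E, O) of theta_add_sub. *)
Lemma theta_three_term (a b d h : Cplx) :
  (theta p (a + d + h) * theta p (a - d) * (theta p (b + h) * theta p b)
   - theta p (a + h) * theta p a * (theta p (b + d + h) * theta p (b - d))
   = theta p (a + b + h) * theta p (a - b) * (theta p (d + h) * theta p d))%cx.
Proof using Hp.
  destruct theta_add_sub as (E & O & H).
  (* The half-shift makes u+v+h and u-v the sum and difference of u+w and v+w; [Q] is the case v =
     0. The four vectors of the Pluecker relation sit at a+w, b+w, d+w and w. *)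
  set (w := (RtoC (1/2)%R * h)%cx).
  assert (Hw : h = (w + w)%cx).
  { unfold w, RtoC, Cmul, Cadd. apply injective_projections; cbn [fst snd]; field. }
  assert (P : forall u v, (theta p (u + v + h) * theta p (u - v)
                = E (u + w) * O (v + w) - O (u + w) * E (v + w))%cx).
  { intros u v. rewrite <- H, Hw. f_equal; f_equal; ring. }
  assert (Q : forall u, (theta p (u + h) * theta p u = E (u + w) * O w - O (u + w) * E w)%cx).
  { intros u. rewrite <- H, Hw. f_equal; f_equal; ring. }
  rewrite !P, !Q. ring.
Qed.
End Theta.

(** * The theta identities behind the exchange relations *)

(** Certificates: the goal follows from known equations with explicit multipliers, and what remains
    is checked by [ring]. *)
Lemma lin_comb1 k P Q A B : P = Q -> (A - B = k * (P - Q))%cx -> A = B.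
Proof. intros -> H. replace A with (B + (A - B))%cx by ring. rewrite H. ring. Qed.

Lemma lin_comb2 k1 k2 P1 Q1 P2 Q2 A B :
  P1 = Q1 -> P2 = Q2 -> (A - B = k1 * (P1 - Q1) + k2 * (P2 - Q2))%cx -> A = B.
Proof. intros -> -> H. replace A with (B + (A - B))%cx by ring. rewrite H. ring. Qed.

Lemma lin_comb3 k1 k2 k3 P1 Q1 P2 Q2 P3 Q3 A B :
  P1 = Q1 -> P2 = Q2 -> P3 = Q3 ->
  (A - B = k1 * (P1 - Q1) + k2 * (P2 - Q2) + k3 * (P3 - Q3))%cx -> A = B.
Proof. intros -> -> -> H. replace A with (B + (A - B))%cx by ring. rewrite H. ring. Qed.

(* Rewrites the theta values of [H] into those of the goal, using that theta is odd. *)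
Ltac match_theta Hp H :=
  repeat match type of H with
  | context [theta ?p ?b] =>
      lazymatch goal with |- context [theta p b] => fail | _ => idtac end;
      match goal with
      | |- context [theta p ?a] =>
          first
            [ replace (theta p b) with (theta p a) in H by (apply f_equal; ring)
            | replace (theta p b) with (- theta p a)%cx in H
                by (rewrite <- (theta_opp p Hp); apply f_equal; ring) ]
      end
  end.

(** Only the four parameters have to be supplied; signs from oddness are matched automatically, and
    both overall signs are tried. *)
Ltac by_three_term Hp a b d h :=
  let H := fresh in
  pose proof (theta_three_term _ Hp a b d h) as H; match_theta Hp H;
  first
    [ apply (lin_comb1 C1 _ _ _ _ H); ring
    | apply (lin_comb1 (- C1)%cx _ _ _ _ H); ring ].

(* The suffix names the exchange relation whose one-site step uses the identity. *)
Section Identities.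
Variables (p : R) (Hp : 0 < p < 1).
Local Notation th := (theta p).
Variables u w s g : Cplx.

Lemma th_BB :
  (th u * th (s - g - w) * th (u - w) * th (s + g) - th (s - u) * th (w + g) * th (s + (u - w)) * th g
   = - (th (s - w) * th (u + g) * th (w - u + g) * th s))%cx.
Proof using Hp. by_three_term Hp g (- s)%cx (- u)%cx w. Qed.

Lemma th_DD :
  (th (s + u) * th (w + g) * th (u - w) * th (s + g) - th u * th (s + g + w) * th (s + (u - w)) * th g
   = - (th w * th (s + g + u) * th (w - u + g) * th s))%cx.
Proof using Hp. by_three_term Hp g (s + g)%cx (- w)%cx (u - g)%cx. Qed.

Lemma th_DB1 :
  (th (u - w) * th (s + u) * th (s - g - g) * th w
   = th (u - w + g) * th (s - g) * th (w + g) * th (s - g + u)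
     - th (s - g + (u - w)) * th g * th (u + g) * th (s - g + w))%cx.
Proof using Hp. by_three_term Hp g (s - g)%cx (- w)%cx u. Qed.

Lemma th_DB2 :
  (th (u - w) * th (s + u) * th (s - g - w) * th g
   = th u * th (w + g) * th (s + (u - w)) * th (s - g)
     - th (s - g + (u - w)) * th (u + g) * th s * th w)%cx.
Proof using Hp. by_three_term Hp g s (- u)%cx (w - s)%cx. Qed.

Lemma th_DB3 :
  (th (u - w) * th (u + g) * th (s + g - w) * th s
   = th (u - w + g) * th (s + g) * th (s - w) * th u
     - th (s + g + (u - w)) * th g * th (s - u) * th w)%cx.
Proof using Hp. by_three_term Hp g (- s)%cx (- u)%cx (w - g)%cx. Qed.

Lemma th_DB4 :
  (th (s + (u - w)) * th (s + g) * th w * th (u + g)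
   = th (s + g + (u - w)) * th u * th (w + g) * th s
     - th (u - w) * th (s - w) * th g * th (s + g + u))%cx.
Proof using Hp. by_three_term Hp g (- s)%cx (- w)%cx (u + s)%cx. Qed.

(** A diagonal entry of R(z) R_21(-z) = [g+z][g-z] on the weight-zero block, with z = u - w and
    denominators cleared. It serves to invert the relation between DB and BD. *)
Lemma th_unitarity :
  (th (u - w + g) * th (w - u + g) * (th s * th s)
   = th (s + (w - u)) * th (s + (u - w)) * (th g * th g)
     - th (s - g) * th (s + g) * (th (u - w) * th (u - w)))%cx.
Proof using Hp. by_three_term Hp g s (u - w)%cx C0. Qed.

(** The factor [2s+g] appears here and in [th_DB5], and cancels between the two in
    [DB_step_false]. *)
Lemma th_cube :
  (th (s + g + g) * th s * (th s * th s) - th (s + g) * th (s - g) * (th (s + g) * th (s + g))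
   = th (s + s + g) * th g * (th g * th g))%cx.
Proof using Hp. by_three_term Hp g s (s + g)%cx C0. Qed.

Lemma th_DB5 :
  (th (s - (u - w)) * th (s - w) * (th (s + g + u) * th (s + g))
   - th (s + g + (u - w)) * th (s - u) * (th (s + g + w) * th s)
   = th (u - w) * th w * (th (u + g) * th (s + s + g)))%cx.
Proof using Hp. by_three_term Hp s w (- s - g)%cx (- u)%cx. Qed.
End Identities.

(** * Exchange relations *)

Definition sum_bool (f : bool -> Cplx) : Cplx := (f true + f false)%cx.

(* The right column of the monodromy matrix, as operators on coefficient functions:
   [column true] is B and [column false] is D, acting on sites i, i+1, ... *)
Fixpoint column (p : R) (g : Cplx) (mu : nat -> Cplx) (x tau : Cplx) (i : nat) (a : bool)
  (e : list bool) (v : list bool -> Cplx) : Cplx :=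
  match e with
  | [] => if a then C0 else v []
  | b' :: r =>
      sum_bool (fun c => sum_bool (fun b =>
        Rel p g (x - mu i) (tau - g * RtoC (hsum r)) a b' c b
        * column p g mu x tau (S i) c r (fun f => v (b :: f))))%cx
  end.

Ltac cplx_ring :=
  unfold RtoC, Csub, Cadd, Copp, Cmul, C0, C1; apply injective_projections; cbn [fst snd INR]; ring.

Section Column.
Variables (p : R) (g : Cplx) (mu : nat -> Cplx).

Lemma column_lin x tau a (e : list bool) k1 k2 (v1 v2 : list bool -> Cplx) : forall i,
  (column p g mu x tau i a e (fun f => k1 * v1 f + k2 * v2 f)
   = k1 * column p g mu x tau i a e v1 + k2 * column p g mu x tau i a e v2)%cx.
Proof using.
  revert a v1 v2. induction e as [|b' r IH]; intros a v1 v2 i.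
  - destruct a; simpl; ring.
  - cbn [column]. unfold sum_bool. rewrite !IH. ring.
Qed.

(* Weight conservation: B flips one spin down and D none. *)
Lemma column_ext x tau (a : bool) (e : list bool) (v1 v2 : list bool -> Cplx) : forall i,
  (forall f, length f = length e -> hsum f = hsum e + (if a then 2 else 0) -> v1 f = v2 f) ->
  column p g mu x tau i a e v1 = column p g mu x tau i a e v2.
Proof using.
  revert a v1 v2. induction e as [|b' r IH]; intros a v1 v2 i H.
  - destruct a; simpl; [reflexivity|]. apply H; simpl; [reflexivity|ring].
  - cbn [column]. simpl hsum in H. simpl length in H.
    assert (K : forall c b, (Rel p g (x - mu i) (tau - g * RtoC (hsum r)) a b' c b
                   * column p g mu x tau (S i) c r (fun f => v1 (b :: f))
                 = Rel p g (x - mu i) (tau - g * RtoC (hsum r)) a b' c b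
                   * column p g mu x tau (S i) c r (fun f => v2 (b :: f)))%cx).
    { intros c b. destruct a, b', c, b; cbn [Rel];
        try (apply f_equal, IH; intros f Hf Hs; apply H; simpl; [lia|rewrite Hs; simpl; ring]);
        ring. }
    unfold sum_bool. now rewrite !K.
Qed.

Definition column2 (a1 a2 : bool) (x y tau : Cplx) (i : nat) (e : list bool)
  (v : list bool -> Cplx) : Cplx :=
  column p g mu x tau i a1 e (fun f => column p g mu y (tau + g)%cx i a2 f v).

(** The second R-matrix sees the row left by the first column. If [c1] is B, the tail weight grows
    by 2, so tau + g turns the local parameter into s - g; if it is D, the weight is unchanged and
    the parameter is s + g. *)
Lemma column2_cons a1 a2 x y tau i b' r v :
  let s := (tau - g * RtoC (hsum r))%cx in
  column2 a1 a2 x y tau i (b' :: r) v =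
  sum_bool (fun c1 => sum_bool (fun b1 => Rel p g (x - mu i) s a1 b' c1 b1 *
    sum_bool (fun c2 => sum_bool (fun b2 =>
      Rel p g (y - mu i) (if c1 then s - g else s + g) a2 b1 c2 b2
      * column2 c1 c2 x y tau (S i) r (fun f => v (b2 :: f))))))%cx.
Proof using.
  intros s.
  assert (E : forall c1 b1,
    (column p g mu x tau (S i) c1 r (fun f => column p g mu y (tau + g) i a2 (b1 :: f) v)
     = sum_bool (fun c2 => sum_bool (fun b2 =>
      Rel p g (y - mu i) (if c1 then s - g else s + g) a2 b1 c2 b2
      * column2 c1 c2 x y tau (S i) r (fun f => v (b2 :: f)))))%cx).
  { intros c1 b1.
    rewrite (column_ext _ _ _ _ _ (fun f => C1 *
       (Rel p g (y - mu i) (if c1 then s - g else s + g) a2 b1 true true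
        * column p g mu y (tau + g) (S i) true f (fun h => v (true :: h))
        + Rel p g (y - mu i) (if c1 then s - g else s + g) a2 b1 true false
        * column p g mu y (tau + g) (S i) true f (fun h => v (false :: h)))
      + C1 *
       (Rel p g (y - mu i) (if c1 then s - g else s + g) a2 b1 false true
        * column p g mu y (tau + g) (S i) false f (fun h => v (true :: h))
        + Rel p g (y - mu i) (if c1 then s - g else s + g) a2 b1 false false
        * column p g mu y (tau + g) (S i) false f (fun h => v (false :: h))))%cx).
    - rewrite !column_lin. unfold column2, sum_bool. ring.
    - intros f _ Hf. cbn [column]. unfold sum_bool.
      replace (tau + g - g * RtoC (hsum f))%cx with (if c1 then s - g else s + g)%cx; [ring|].
      unfold s. rewrite Hf.
      destruct c1; unfold RtoC, Cadd, Csub, Copp, Cmul, Cadd; apply injective_projections;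
        cbn [fst snd]; ring. }
  transitivity (sum_bool (fun c1 => sum_bool (fun b1 => Rel p g (x - mu i) s a1 b' c1 b1 *
    column p g mu x tau (S i) c1 r (fun f => column p g mu y (tau + g) i a2 (b1 :: f) v))))%cx.
  { reflexivity. }
  unfold sum_bool in *. now rewrite !E.
Qed.

(** The window for rows of n sites: a tail has at most n-1 spins, and one further shift by g in
    either direction occurs. *)
Definition regular (n : nat) (tau : Cplx) : Prop :=
  forall m : Z, (- Z.of_nat n <= m <= Z.of_nat n)%Z -> theta p (tau + RtoC (IZR m) * g)%cx <> C0.

Lemma hsum_IZR (r : list bool) :
  exists m : Z, hsum r = IZR m /\ (- Z.of_nat (length r) <= m <= Z.of_nat (length r))%Z.
Proof using.
  induction r as [|b r (m & Hm & Hr)].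
  - exists 0%Z. simpl. split; [reflexivity|lia].
  - exists ((if b then 1 else -1) + m)%Z. simpl hsum. rewrite Hm, plus_IZR.
    destruct b; cbn [hval length]; split; first [lia | reflexivity].
Qed.

Lemma regular_shift n tau r k :
  regular n tau -> (Z.of_nat (length r) + Z.abs k <= Z.of_nat n)%Z ->
  theta p (tau - g * RtoC (hsum r) + RtoC (IZR k) * g)%cx <> C0.
Proof using.
  intros H Hk. destruct (hsum_IZR r) as (m & -> & Hm).
  replace (tau - g * RtoC (IZR m) + RtoC (IZR k) * g)%cx with (tau + RtoC (IZR (k - m)) * g)%cx.
  - apply H. lia.
  - rewrite minus_IZR. unfold RtoC, Cadd, Csub, Copp, Cmul, Cadd; apply injective_projections;
        cbn [fst snd]; ring.
Qed.

Hypothesis Hp : 0 < p < 1.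
Local Notation th := (theta p).

(** A component of the dynamical Yang-Baxter algebra evaluated on the row [e], with denominators
    cleared. *)
Definition DB_relation x y tau i e v : Prop :=
  let s := (tau - g * RtoC (hsum e))%cx in
  (th (x - y) * th (s + g) * column2 false true x y tau i e v
   = th (x - y + g) * th s * column2 true false y x tau i e v
     - th (s + (x - y)) * th g * column2 true false x y tau i e v)%cx.

(* Written in terms of B D(x,y) and D B(x,y), the coefficients in [DB_step_false] below
   reduce to three-term relations. *)
Lemma DB_relation_dual s (z BDxy BDyx DBxy DByx : Cplx) :
  th z <> C0 -> th (s + g)%cx <> C0 ->
  (th z * th (s + g) * DBxy = th (z + g) * th s * BDyx - th (s + z) * th g * BDxy)%cx ->
  (th (- z) * th (s + g) * DByx = th (- z + g) * th s * BDxy - th (s - z) * th g * BDyx)%cx ->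
  (th (z + g) * th s * DByx = th (s - g) * th z * BDxy + th (s - z) * th g * DBxy)%cx.
Proof using Hp.
  intros Hz Hs H1 H2.
  apply (Cmul_cancel_l (th z * th (s + g))%cx); [now apply Cmul_neq_0|].
  rewrite (theta_opp p Hp z) in H2.
  transitivity (- (th (z + g) * th s * (- th z * th (s + g) * DByx)))%cx; [ring|]. rewrite H2.
  transitivity (th z * th (s + g) * (th (s - g) * th z * BDxy)
     + th (s - z) * th g * (th z * th (s + g) * DBxy))%cx; [|ring]. rewrite H1.
  (* Once BD(y,x) is eliminated, the coefficient of BD(x,y) factors exactly by unitarity. *)
  pose proof (th_unitarity p Hp z C0 s g) as U.
  replace (z - C0)%cx with z in U by ring. replace (C0 - z)%cx with (- z)%cx in U by ring.
  replace (s + - z)%cx with (s - z)%cx in U by ring.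
  transitivity (- (th (z + g) * th (- z + g) * (th s * th s)) * BDxy
     + th (z + g) * th s * (th (s - z) * th g * BDyx))%cx; [ring|]. rewrite U. ring.
Qed.

(** Head spin up: the parameter of the whole row is s - g. One tail relation removes DB; the
    coefficients left over, those of BB and BD(x,y), are [th_DB1] and [th_DB2]. *)
Lemma DB_step_true u w s BDxy BDyx DBxy BB :
  th s <> C0 -> th (s - g)%cx <> C0 ->
  (th (u - w) * th (s + g) * DBxy
   = th (u - w + g) * th s * BDyx - th (s + (u - w)) * th g * BDxy)%cx ->
  (th (u - w) * th s *
     (th (s + g) * th u / th s * (th (w + g) * DBxy)
      + th (s + u) * th g / th s
        * (th (s - g - g) * th w / th (s - g) * BB + th (s - g - w) * th g / th (s - g) * BDxy))
   = th (u - w + g) * th (s - g) *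
     (th (w + g) * (th s * th u / th (s - g) * BDyx + th (s - g + u) * th g / th (s - g) * BB))
     - th (s - g + (u - w)) * th g *
     (th (u + g) * (th s * th w / th (s - g) * BDxy + th (s - g + w) * th g / th (s - g) * BB)))%cx.
Proof using Hp.
  intros Hs Hsm H.
  apply (Cmul_cancel_l (th (s - g)%cx)); [exact Hsm|].
  transitivity (th u * th (w + g) * th (s - g) * (th (u - w) * th (s + g) * DBxy)
    + th (u - w) * th (s + u) * th g * (th (s - g - g) * th w * BB + th (s - g - w) * th g * BDxy))%cx;
    [field; split; assumption|].
  transitivity (th (u - w + g) * th (s - g) * th (w + g) * (th s * th u * BDyx + th (s - g + u) * th g * BB)
     - th (s - g + (u - w)) * th g * th (u + g) * (th s * th w * BDxy + th (s - g + w) * th g * BB))%cx;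
    [|field; assumption].
  apply (lin_comb3 (th u * th (w + g) * th (s - g)) (th g * BB) (th g * BDxy) _ _ _ _ _ _ _ _
           H (th_DB1 p Hp u w s g) (th_DB2 p Hp u w s g))%cx.
  ring.
Qed.

(** Head spin down: the parameter is s + g, and DB of the tail occurs in both orders. The dual
    relation removes DB(y,x); then DD is settled by [th_DB3], BD(x,y) by [th_DB4], and DB(x,y) by
    [th_cube] with [th_DB5]. *)
Lemma DB_step_false u w s BDxy BDyx DBxy DByx DD :
  th (u - w)%cx <> C0 -> th s <> C0 -> th (s + g)%cx <> C0 ->
  (th (u - w) * th (s + g) * DBxy
   = th (u - w + g) * th s * BDyx - th (s + (u - w)) * th g * BDxy)%cx ->
  (th (w - u) * th (s + g) * DByx
   = th (w - u + g) * th s * BDxy - th (s + (w - u)) * th g * BDyx)%cx ->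
  (th (u - w) * th (s + g + g) *
     (th (u + g) * (th s * th w / th (s + g) * DBxy + th (s + g - w) * th g / th (s + g) * DD))
   = th (u - w + g) * th (s + g) *
     (th (s - g) * th w / th s * (th (u + g) * BDyx)
      + th (s - w) * th g / th s
        * (th (s + g + g) * th u / th (s + g) * DD + th (s + g + u) * th g / th (s + g) * DByx))
     - th (s + g + (u - w)) * th g *
     (th (s - g) * th u / th s * (th (w + g) * BDxy)
      + th (s - u) * th g / th s
        * (th (s + g + g) * th w / th (s + g) * DD + th (s + g + w) * th g / th (s + g) * DBxy)))%cx.
Proof using Hp.
  intros Hz Hs Hsp H1 H2.
  assert (H3 : (th (u - w + g) * th s * DByx
                = th (s - g) * th (u - w) * BDxy + th (s - (u - w)) * th g * DBxy)%cx).
  { apply (DB_relation_dual s (u - w)%cx BDxy BDyx); auto.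
    replace (- (u - w))%cx with (w - u)%cx by ring.
    replace (s - (u - w))%cx with (s + (w - u))%cx by ring. exact H2. }
  apply (Cmul_cancel_l (th s * th s * th (s + g))%cx); [apply Cmul_neq_0; [apply Cmul_neq_0|]; assumption|].
  transitivity (th (u - w) * th (s + g + g) * th (u + g) * th s * th s *
     (th s * th w * DBxy + th (s + g - w) * th g * DD))%cx; [field; assumption|].
  transitivity (th (u - w + g) * th (s + g) * th s *
      (th (s + g) * th (s - g) * th w * th (u + g) * BDyx
       + th (s - w) * th g * (th (s + g + g) * th u * DD + th (s + g + u) * th g * DByx))
     - th (s + g + (u - w)) * th g * th s *
      (th (s + g) * th (s - g) * th u * th (w + g) * BDxy
       + th (s - u) * th g * (th (s + g + g) * th w * DD + th (s + g + w) * th g * DBxy)))%cx;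
    [|field; split; assumption].
  pose proof (th_DB3 p Hp u w s g) as I3. pose proof (th_DB4 p Hp u w s g) as I4.
  pose proof (th_cube p Hp s g) as I5. pose proof (th_DB5 p Hp u w s g) as I6.
  apply (lin_comb3 (th (s + g) * th (s + g) * th (s - g) * th w * th (u + g))
                   (- (th (s + g) * th (s - w) * th g * th g * th (s + g + u)))
                   (th s * th g * th (s + g + g) * DD) _ _ _ _ _ _ _ _ H1 H3 I3)%cx.
  (* What the first combination leaves is again a combination of theta identities, now multiplied by
     BD(x,y) and DB(x,y). *)
  apply (lin_comb3 (- (th g * th (s + g) * th (s - g) * BDxy))
                   (th (u - w) * th (u + g) * th w * DBxy)
                   (- (th g * th g * th g * DBxy)) _ _ _ _ _ _ _ _ I4 I5 I6)%cx.
  ring.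
Qed.

(** The right side changes sign when (u, BD(x,y)) and (w, BD(y,x)) are swapped, and so does [u-w] on
    the left; adding the two versions gives the symmetry of BB. [DD_step] works the same way. *)
Lemma BB_step u w s BDxy BDyx DBxy :
  th (u - w)%cx <> C0 -> th s <> C0 -> th (s + g)%cx <> C0 -> th (s - g)%cx <> C0 ->
  (th (u - w) * th (s + g) * DBxy
   = th (u - w + g) * th s * BDyx - th (s + (u - w)) * th g * BDxy)%cx ->
  (th (u - w) * th (s + g) *
     (th (s - g) * th u / th s * (th (s - g - w) * th g / th (s - g) * BDxy)
      + th (s - u) * th g / th s * (th (w + g) * DBxy))
   = th g * (th (s - u) * th (w + g) * th (u - w + g) * BDyx
             - th (s - w) * th (u + g) * th (w - u + g) * BDxy))%cx.
Proof using Hp.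
  intros Hz Hs Hsp Hsm H.
  apply (Cmul_cancel_l (th s)); [exact Hs|].
  transitivity (th g * (th u * th (s - g - w) * th (u - w) * th (s + g) * BDxy
     + th (s - u) * th (w + g) * (th (u - w) * th (s + g) * DBxy)))%cx; [field; split; assumption|].
  apply (lin_comb2 (th g * th (s - u) * th (w + g)) (th g * BDxy) _ _ _ _ _ _
           H (th_BB p Hp u w s g))%cx.
  ring.
Qed.

Lemma DD_step u w s BDxy BDyx DBxy :
  th (u - w)%cx <> C0 -> th s <> C0 -> th (s + g)%cx <> C0 ->
  (th (u - w) * th (s + g) * DBxy
   = th (u - w + g) * th s * BDyx - th (s + (u - w)) * th g * BDxy)%cx ->
  (th (u - w) * th (s + g) *
     (th (s + g) * th u / th s * (th (s + g + w) * th g / th (s + g) * DBxy)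
      + th (s + u) * th g / th s * (th (w + g) * BDxy))
   = th g * (th u * th (s + g + w) * th (u - w + g) * BDyx
             - th w * th (s + g + u) * th (w - u + g) * BDxy))%cx.
Proof using Hp.
  intros Hz Hs Hsp H.
  apply (Cmul_cancel_l (th s)); [exact Hs|].
  transitivity (th g * (th (s + u) * th (w + g) * th (u - w) * th (s + g) * BDxy
     + th u * th (s + g + w) * (th (u - w) * th (s + g) * DBxy)))%cx; [field; split; assumption|].
  apply (lin_comb2 (th g * th u * th (s + g + w)) (th g * BDxy) _ _ _ _ _ _
           H (th_DD p Hp u w s g))%cx.
  ring.
Qed.

(** The four claims need a joint induction: the steps for BB and DD use DB of the tail, and the
    steps for DB use the symmetry of BB and DD and, with head spin down, DB in both orders. *)
Lemma exchange x y tau e : th (x - y)%cx <> C0 -> regular (length e) tau -> forall i v,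
  column2 true true x y tau i e v = column2 true true y x tau i e v
  /\ column2 false false x y tau i e v = column2 false false y x tau i e v
  /\ DB_relation x y tau i e v /\ DB_relation y x tau i e v.
Proof using Hp.
  intros Hxy. assert (Hyx : th (y - x)%cx <> C0).
  { replace (y - x)%cx with (- (x - y))%cx by ring. rewrite (theta_opp p Hp). intros H.
    apply Hxy. replace (th (x - y)%cx) with (- - th (x - y))%cx by ring. rewrite H. ring. }
  induction e as [|b' r IH]; intros Hreg i v.
  - unfold DB_relation, column2. simpl. repeat split; ring.
  - assert (Hr : regular (length r) tau) by (intros m Hm; apply Hreg; simpl length; lia).
    set (s := (tau - g * RtoC (hsum r))%cx).
    assert (Hk : forall k, (Z.abs k <= 1)%Z -> th (s + RtoC (IZR k) * g)%cx <> C0).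
    { intros k Hk. apply (regular_shift _ _ _ _ Hreg). simpl length. lia. }
    assert (Hs : th s <> C0).
    { replace s with (s + RtoC (IZR 0) * g)%cx by cplx_ring. apply Hk. lia. }
    assert (Hsp : th (s + g)%cx <> C0).
    { replace (s + g)%cx with (s + RtoC (IZR 1) * g)%cx by cplx_ring. apply Hk. lia. }
    assert (Hsm : th (s - g)%cx <> C0).
    { replace (s - g)%cx with (s + RtoC (IZR (-1)) * g)%cx by cplx_ring. apply Hk. lia. }
    destruct (IH Hr (S i) (fun f => v (true :: f))) as (BBt & DDt & DBt & DBt').
    destruct (IH Hr (S i) (fun f => v (false :: f))) as (BBf & DDf & DBf & DBf').
    clear IH.
    set (u := (x - mu i)%cx). set (w := (y - mu i)%cx).
    assert (Euw : (x - y = u - w)%cx) by (unfold u, w; ring).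
    assert (Ewu : (y - x = w - u)%cx) by (unfold u, w; ring).
    assert (Eh : (tau - g * RtoC (hsum (b' :: r)) = if b' then s - g else s + g)%cx).
    { unfold s. destruct b'; simpl hsum; cplx_ring. }
    unfold DB_relation in *. rewrite !Eh. fold s in DBt, DBt', DBf, DBf'.
    rewrite !column2_cons. fold s u w. rewrite !Euw, !Ewu in *. unfold sum_bool.
    rewrite <- ?BBt, <- ?BBf, <- ?DDt, <- ?DDf.
    clear BBt BBf DDt DDf.
    set (BBf := column2 true true x y tau (S i) r (fun f => v (false :: f))) in *.
    set (DDt := column2 false false x y tau (S i) r (fun f => v (true :: f))) in *.
    assert (Eg : (s - g + g = s)%cx) by ring. assert (Eg' : (s + g - g = s)%cx) by ring.
    assert (Eo : th (w - u)%cx = (- th (u - w))%cx).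
    { rewrite <- (theta_opp p Hp). f_equal. ring. }
    assert (HK : (th (u - w) * th (s + g))%cx <> C0) by now apply Cmul_neq_0.
    (* BB with head up and DD with head down keep a single tail term, so their symmetry is inherited
       directly. *)
    destruct b'; cbn [Rel]; rewrite ?Eg, ?Eg'; repeat split.
    + ring.
    + apply (Cmul_cancel_l _ _ _ HK).
      pose proof (DD_step u w s _ _ _ Hxy Hs Hsp DBf) as E1.
      pose proof (DD_step w u s _ _ _ Hyx Hs Hsp DBf') as E2. rewrite Eo in E2.
      apply (lin_comb2 C1 C1 _ _ _ _ _ _ E1 E2). unfold Cdiv. ring.
    + apply (lin_comb1 C1 _ _ _ _ (DB_step_true u w s _ _ _ BBf Hs Hsm DBt)). unfold Cdiv. ring.
    + apply (lin_comb1 C1 _ _ _ _ (DB_step_true w u s _ _ _ BBf Hs Hsm DBt')). unfold Cdiv. ring.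
    + apply (Cmul_cancel_l _ _ _ HK).
      pose proof (BB_step u w s _ _ _ Hxy Hs Hsp Hsm DBt) as E1.
      pose proof (BB_step w u s _ _ _ Hyx Hs Hsp Hsm DBt') as E2. rewrite Eo in E2.
      apply (lin_comb2 C1 C1 _ _ _ _ _ _ E1 E2). unfold Cdiv. ring.
    + ring.
    + apply (lin_comb1 C1 _ _ _ _ (DB_step_false u w s _ _ _ _ DDt Hxy Hs Hsp DBf DBf')).
      unfold Cdiv. ring.
    + apply (lin_comb1 C1 _ _ _ _ (DB_step_false w u s _ _ _ _ DDt Hyx Hs Hsp DBf' DBf)).
      unfold Cdiv. ring.
Qed.
End Column.

(** * Finite products and replacement of one variable *)

Definition Cprod {I : Type} (f : I -> Cplx) (l : list I) : Cplx :=
  fold_right (fun i s => Cmul (f i) s) C1 l.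

Lemma Cprod_app {I : Type} (f : I -> Cplx) l1 l2 : Cprod f (l1 ++ l2) = (Cprod f l1 * Cprod f l2)%cx.
Proof. induction l1; simpl; [ring|]. rewrite IHl1. ring. Qed.

Lemma Cprod_ext {I : Type} (f h : I -> Cplx) l :
  (forall i, In i l -> f i = h i) -> Cprod f l = Cprod h l.
Proof.
  induction l as [|a l IH]; intros H; simpl; [reflexivity|].
  rewrite (H a (or_introl eq_refl)), IH; [reflexivity|]. intros i Hi. apply H. now right.
Qed.

Lemma Cprod_mul {I : Type} (f h : I -> Cplx) l :
  Cprod (fun i => f i * h i)%cx l = (Cprod f l * Cprod h l)%cx.
Proof. induction l; simpl; [ring|]. rewrite IHl. ring. Qed.

Lemma Cprod_neq_0 {I : Type} (f : I -> Cplx) l :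
  (forall i, In i l -> f i <> C0) -> Cprod f l <> C0.
Proof.
  induction l as [|a l IH]; intros H; simpl.
  - intros E. apply (f_equal fst) in E. simpl in E. lra.
  - apply Cmul_neq_0; [apply H; now left|]. apply IH. intros i Hi. apply H. now right.
Qed.

Lemma replace_at_same xs i z : replace_at xs i z i = z.
Proof. unfold replace_at. now rewrite Nat.eqb_refl. Qed.

Lemma replace_at_other xs i z j : j <> i -> replace_at xs i z j = xs j.
Proof. intros H. unfold replace_at. apply Nat.eqb_neq in H. now rewrite H. Qed.

Lemma map_replace_at_notin xs i z l : ~ In i l -> map (replace_at xs i z) l = map xs l.
Proof.
  intros H. apply map_ext_in. intros j Hj. apply replace_at_other. congruence.
Qed.

Lemma permutation_replace_at xs i a b l : NoDup l -> In i l ->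
  Permutation (a :: map (replace_at xs i b) l) (b :: map (replace_at xs i a) l).
Proof.
  intros Hn Hi. apply in_split in Hi. destruct Hi as (l1 & l2 & ->).
  pose proof (NoDup_remove_2 _ _ _ Hn) as Hni. rewrite in_app_iff in Hni.
  rewrite !map_app. simpl. rewrite !replace_at_same, !map_replace_at_notin by tauto.
  transitivity (a :: b :: map xs l1 ++ map xs l2).
  - apply perm_skip. symmetry. apply Permutation_middle.
  - transitivity (b :: a :: map xs l1 ++ map xs l2); [apply perm_swap|].
    apply perm_skip. apply Permutation_middle.
Qed.

(** * Moving D through a product of B operators *)

Section Transfer.
Variables (p : R) (g : Cplx) (mu : nat -> Cplx).
Hypothesis Hp : 0 < p < 1.
Local Notation th := (theta p).
Local Notation col := (column p g mu).

Lemma th_sub_neq_0 x y : th (x - y)%cx <> C0 -> th (y - x)%cx <> C0.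
Proof using Hp.
  intros H E. apply H. replace (x - y)%cx with (- (y - x))%cx by ring.
  rewrite (theta_opp p Hp), E. ring.
Qed.

Lemma column_Csum {I : Type} x tau i a e (c : I -> Cplx) (V : I -> list bool -> Cplx) l :
  (col x tau i a e (fun f => Csum (fun j => c j * V j f) l)
   = Csum (fun j => c j * col x tau i a e (V j)) l)%cx.
Proof using.
  induction l as [|j l IH]; simpl.
  - rewrite (column_ext p g mu x tau a e _ (fun f => C0 * C0 + C0 * C0)%cx).
    + rewrite column_lin. ring.
    + intros. ring.
  - rewrite (column_ext p g mu x tau a e _
      (fun f => c j * V j f + C1 * Csum (fun j => c j * V j f) l)%cx).
    + rewrite column_lin, IH. ring.
    + intros. ring.
Qed.

Fixpoint Bprod (tau : Cplx) (l : list Cplx) (v : list bool -> Cplx) : list bool -> Cplx :=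
  match l with
  | [] => v
  | x :: l' => fun e => col x tau 1%nat true e (Bprod (tau + g)%cx l' v)
  end.

(** Quantifying over permutations covers any two positions and makes the condition stable under
    reordering, as induction on [Permutation] requires. *)
Definition separated (l : list Cplx) : Prop :=
  forall x y l', Permutation l (x :: y :: l') -> th (x - y)%cx <> C0.

Lemma separated_map {I : Type} (h : I -> Cplx) (l : list I) :
  NoDup l -> (forall i j, In i l -> In j l -> i <> j -> th (h i - h j)%cx <> C0) ->
  separated (map h l).
Proof using.
  intros Hl H x y l' HP. apply Permutation_sym, Permutation_map_inv in HP. destruct HP as (s & E & Hs).
  destruct s as [|i [|j s]]; try discriminate. injection E as -> -> _.
  pose proof (Permutation_NoDup Hs Hl) as Hn. inversion Hn as [|? ? H1 H2]; subst.
  apply H.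
  - apply (Permutation_in _ (Permutation_sym Hs)). now left.
  - apply (Permutation_in _ (Permutation_sym Hs)). right. now left.
  - intros ->. apply H1. now left.
Qed.

(** Parameters belong to positions, not to variables, so swapping neighbours is the BB relation at
    the parameter of the first. The last operator has no right neighbour, hence [S j < length l]. *)
Lemma Bprod_permutation L v l l' : Permutation l l' -> forall tau e,
  length e = L -> separated l ->
  (forall j, (S j < length l)%nat -> regular p g L (tau + RtoC (INR j) * g)%cx) ->
  Bprod tau l v e = Bprod tau l' v e.
Proof using Hp.
  intros HP. induction HP as [|x l l' HP IH|x y l|l l' l'' HP1 IH1 HP2 IH2];
    intros tau e He Hs Hreg.
  - reflexivity.
  - cbn [Bprod]. apply column_ext. intros f Hf _. apply IH; [congruence| |].
    + intros a b m Hm. apply (Hs a b (x :: m)).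
      transitivity (x :: a :: b :: m); [now constructor|].
      transitivity (a :: x :: b :: m); [apply perm_swap|]. apply perm_skip, perm_swap.
    + intros j Hj. replace (tau + g + RtoC (INR j) * g)%cx with (tau + RtoC (INR (S j)) * g)%cx
        by (rewrite S_INR; cplx_ring). apply Hreg. simpl. lia.
  - cbn [Bprod]. apply (exchange p g mu Hp y x tau e).
    + apply (Hs y x l). reflexivity.
    + subst L. replace tau with (tau + RtoC (INR 0) * g)%cx by cplx_ring.
      apply Hreg. simpl. lia.
  - rewrite IH1 by assumption. apply IH2; auto.
    + intros a b m Hm. apply (Hs a b m). now transitivity l'.
    + intros j Hj. apply Hreg. now rewrite (Permutation_length HP1).
Qed.

Definition bethe_factor (x y : Cplx) : Cplx := (th (x - y + g) / th (x - y))%cx.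

(** The overview's c_i(x) without the factor prod_j [x_i - mu_j]; there s = tau + (L+1)g. *)
Definition bethe_coef (s x : Cplx) (xs : nat -> Cplx) (l : list nat) (i : nat) : Cplx :=
  (th g * th (s + (x - xs i)) / (th s * th (x - xs i))
   * Cprod (fun j => if Nat.eqb j i then C1 else bethe_factor (xs i) (xs j)) l)%cx.

(* D(x_i) is reached from D(x) B(x_k) either through D(x) or through D(x_k). *)
Lemma bethe_coef_cons s x xs k l i :
  th s <> C0 -> th (s - g)%cx <> C0 -> th (x - xs i)%cx <> C0 -> th (xs k - xs i)%cx <> C0 ->
  i <> k ->
  (th (x - xs k + g) * th s * bethe_coef (s - g) x xs l i
   - th (s + (x - xs k)) * th g * bethe_coef (s - g) (xs k) xs l i
   = th (x - xs k) * th s * bethe_coef s x xs (k :: l) i)%cx.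
Proof using Hp.
  intros Hs Hsm Hx Hk Hik. unfold bethe_coef. cbn [Cprod fold_right].
  apply Nat.eqb_neq in Hik. rewrite Nat.eqb_sym in Hik. rewrite Hik.
  fold (Cprod (fun j => if Nat.eqb j i then C1 else bethe_factor (xs i) (xs j)) l).
  set (Q := Cprod _ l). unfold bethe_factor.
  set (z := (x - xs k)%cx). set (r := (xs k - xs i)%cx) in *.
  assert (Er : th (xs i - xs k)%cx = (- th r)%cx).
  { rewrite <- (theta_opp p Hp). f_equal. unfold r. ring. }
  assert (Ez : (x - xs i = z + r)%cx) by (unfold z, r; ring).
  replace (xs i - xs k + g)%cx with (g - r)%cx by (unfold r; ring).
  rewrite Er, Ez in *.
  assert (Hr : (- th r)%cx <> C0).
  { intros E. apply Hk. replace (th r) with (- - th r)%cx by ring. rewrite E. ring. }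
  assert (K : (th (z + g) * th s * th (s - g + (z + r)) * th r
     - th (s + z) * th g * th (s - g + r) * th (z + r)
     = - (th z * th (s + (z + r)) * th (g - r) * th (s - g)))%cx).
  { by_three_term Hp g s (- z)%cx (- r - s)%cx. }
  assert (Hr' : th r <> C0) by exact Hk.
  apply (Cmul_cancel_l (th (s - g) * th (z + r) * th r)%cx).
  { apply Cmul_neq_0; [apply Cmul_neq_0|]; assumption. }
  transitivity (th g * Q * (th (z + g) * th s * th (s - g + (z + r)) * th r
     - th (s + z) * th g * th (s - g + r) * th (z + r)))%cx; [field; auto|].
  rewrite K. field. auto.
Qed.

(** Each exchange contributes [s]/[s+g] with s lowered by g, and these ratios telescope. The
    eigenvalue of D on [v] is split so that its x-independent part [kap] factors out of all
    terms. *)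
Lemma D_through_B L xs v kap lam : forall m k tau e x0,
  let s := (tau - g * RtoC (hsum e))%cx in
  length e = L ->
  (forall j, (j < m)%nat -> regular p g L (tau + RtoC (INR j) * g)%cx) ->
  (forall j, (j <= m)%nat -> th (s + g - RtoC (INR j) * g)%cx <> C0) ->
  (forall j, In j (seq k m) -> th (x0 - xs j)%cx <> C0) ->
  (forall i j, In i (seq k m) -> In j (seq k m) -> i <> j -> th (xs i - xs j)%cx <> C0) ->
  (forall x f, length f = L ->
     col x (tau + RtoC (INR m) * g)%cx 1%nat false f v = kap * lam x * v f)%cx ->
  (col x0 tau 1%nat false e (Bprod (tau + g) (map xs (seq k m)) v)
   = kap * (th (s + g - RtoC (INR m) * g) / th (s + g))
     * (Cprod (fun j => bethe_factor x0 (xs j)) (seq k m) * lam x0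
          * Bprod tau (map xs (seq k m)) v e
        - Csum (fun i => bethe_coef s x0 xs (seq k m) i * lam (xs i)
            * Bprod tau (map (replace_at xs i x0) (seq k m)) v e) (seq k m)))%cx.
Proof using Hp.
  induction m as [|m IH]; intros k tau e x0 s He Hreg Hs Hx0 Hxs Hv.
  - cbn [seq map Bprod Cprod Csum fold_right].
    replace tau with (tau + RtoC (INR 0) * g)%cx at 1 by cplx_ring. rewrite Hv by exact He.
    assert (E : (s + g - RtoC (INR 0) * g = s + g)%cx) by cplx_ring.
    specialize (Hs 0%nat (le_n _)). rewrite E in *. field. exact Hs.
  - set (S' := seq (S k) m). set (y := xs k). cbn [seq]. fold S'.
    assert (Hkm : In k (seq k (S m))) by (apply in_seq; lia).
    assert (HS : forall j, In j S' -> In j (seq k (S m)) /\ j <> k).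
    { intros j Hj. apply in_seq in Hj. split; [apply in_seq|]; lia. }
    assert (Hsp : th (s + g)%cx <> C0).
    { replace (s + g)%cx with (s + g - RtoC (INR 0) * g)%cx by cplx_ring. apply Hs. lia. }
    assert (Hs0 : th s <> C0).
    { replace s with (s + g - RtoC (INR 1) * g)%cx by cplx_ring. apply Hs. lia. }
    assert (Hz : th (x0 - y)%cx <> C0) by now apply Hx0.
    assert (Hreg0 : regular p g (length e) tau).
    { rewrite He. replace tau with (tau + RtoC (INR 0) * g)%cx by cplx_ring. apply Hreg. lia. }
    set (rho := th (s + g - RtoC (INR (S m)) * g)%cx).
    set (W := Bprod (tau + g + g)%cx (map xs S') v).
    (* The induction hypothesis below one B operator, whose action lowers the local parameter to s -
       g. It is used for both terms of the exchange relation. *)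
    assert (HIH : forall a b, (forall j, In j S' -> th (b - xs j)%cx <> C0) ->
      (col a tau 1%nat true e (fun f => col b (tau + g) 1%nat false f W)
       = kap * (rho / th s) * (Cprod (fun j => bethe_factor b (xs j)) S' * lam b
            * Bprod tau (a :: map xs S') v e
          - Csum (fun i => bethe_coef (s - g) b xs S' i * lam (xs i)
              * Bprod tau (a :: map (replace_at xs i b) S') v e) S'))%cx).
    { intros a b Hb.
      transitivity (col a tau 1%nat true e (fun f =>
        (kap * (rho / th s) * (Cprod (fun j => bethe_factor b (xs j)) S' * lam b))
          * Bprod (tau + g) (map xs S') v f
        + (- (kap * (rho / th s))) * Csum (fun i => (bethe_coef (s - g) b xs S' i * lam (xs i))
            * Bprod (tau + g) (map (replace_at xs i b) S') v f) S'))%cx.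
      - apply column_ext. intros f Hf Hh. unfold W, S'.
        assert (Ef : (tau + g - g * RtoC (hsum f) = s - g)%cx) by (unfold s; rewrite Hh; cplx_ring).
        rewrite (IH (S k) (tau + g)%cx f b).
        + fold S'. rewrite Ef.
          replace (s - g + g - RtoC (INR m) * g)%cx with (s + g - RtoC (INR (S m)) * g)%cx
            by (rewrite S_INR; cplx_ring).
          fold rho. replace (s - g + g)%cx with s by ring. unfold Cdiv. ring.
        + congruence.
        + intros j Hj. replace (tau + g + RtoC (INR j) * g)%cx with (tau + RtoC (INR (S j)) * g)%cx
            by (rewrite S_INR; cplx_ring). apply Hreg. lia.
        + intros j Hj. rewrite Ef.
          replace (s - g + g - RtoC (INR j) * g)%cx with (s + g - RtoC (INR (S j)) * g)%cx
            by (rewrite S_INR; cplx_ring). apply Hs. lia.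
        + exact Hb.
        + intros i j Hi Hj. apply Hxs; now apply HS.
        + intros x f' Hf'.
          replace (tau + g + RtoC (INR m) * g)%cx with (tau + RtoC (INR (S m)) * g)%cx
            by (rewrite S_INR; cplx_ring). now apply Hv.
      - rewrite column_lin.
        rewrite (column_Csum a tau 1%nat true e _ (fun i => Bprod (tau + g)%cx (map (replace_at xs i b) S') v)).
        cbn [Bprod]. ring. }
    destruct (exchange p g mu Hp x0 y tau e Hz Hreg0 1%nat W) as (_ & _ & HDB & _).
    unfold DB_relation, column2 in HDB. fold s in HDB.
    apply (Cmul_cancel_l (th (x0 - y) * th (s + g))%cx); [now apply Cmul_neq_0|].
    cbn [map Bprod]. fold y. fold W.
    etransitivity; [exact HDB|].
    rewrite (HIH y x0), (HIH x0 y); [| |].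
    2: { intros j Hj. apply Hxs; [exact Hkm| |]; apply HS in Hj; intuition. }
    2: { intros j Hj. apply Hx0. now apply HS. }
    cbn [Cprod Csum fold_right]. fold (Cprod (fun j => bethe_factor x0 (xs j)) S').
    match goal with |- context [(_ + fold_right ?h C0 S')%cx] =>
      change (fold_right h C0 S') with (Csum (fun i => bethe_coef s x0 xs (k :: S') i * lam (xs i)
            * Bprod tau (map (replace_at xs i x0) (k :: S')) v e)%cx S') end.
    (* The term i = k has a single source: the exchange turns D(x0) into D(x_k), which then passes
       all remaining B operators unchanged. *)
    assert (HC : bethe_coef s x0 xs (k :: S') k
      = (th g * th (s + (x0 - y)) / (th s * th (x0 - y))
         * Cprod (fun j => bethe_factor y (xs j)) S')%cx).
    { unfold bethe_coef. cbn [Cprod fold_right]. rewrite Nat.eqb_refl. fold y.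
      fold (Cprod (fun j => if Nat.eqb j k then C1 else bethe_factor y (xs j)) S').
      rewrite (Cprod_ext _ (fun j => bethe_factor y (xs j)) S'); [ring|].
      intros j Hj. apply HS in Hj. destruct Hj as [_ Hj]. apply Nat.eqb_neq in Hj. now rewrite Hj. }
    rewrite HC.
    assert (HSum :
      (th (x0 - y + g) * th s * Csum (fun i => bethe_coef (s - g) x0 xs S' i * lam (xs i)
            * Bprod tau (y :: map (replace_at xs i x0) S') v e) S'
       - th (s + (x0 - y)) * th g * Csum (fun i => bethe_coef (s - g) y xs S' i * lam (xs i)
            * Bprod tau (x0 :: map (replace_at xs i y) S') v e) S'
       = th (x0 - y) * th s * Csum (fun i => bethe_coef s x0 xs (k :: S') i * lam (xs i)
            * Bprod tau (map (replace_at xs i x0) (k :: S')) v e) S')%cx).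
    { rewrite <- !Csum_scal, <- Csum_sub. apply Csum_ext. intros i Hi.
      destruct (HS i Hi) as [Hi' Hik].
      (* An index in [S'] forces m >= 1, so the bound 2 <= S m holds. *)
      assert (Hsm : th (s - g)%cx <> C0).
      { replace (s - g)%cx with (s + g - RtoC (INR 2) * g)%cx by cplx_ring. apply Hs.
        apply in_seq in Hi. lia. }
      (* The two routes to D(x_i) leave the same variables behind in different order. *)
      assert (HP : Bprod tau (x0 :: map (replace_at xs i y) S') v e
                   = Bprod tau (y :: map (replace_at xs i x0) S') v e).
      { apply (Bprod_permutation L); auto.
        - apply permutation_replace_at; [apply seq_NoDup|exact Hi].
        (* A double replacement presents the list as a map over distinct indices, as [separated_map]
           expects. *)
        - replace (x0 :: map (replace_at xs i y) S')
            with (map (replace_at (replace_at xs i y) k x0) (seq k (S m))).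
          + apply separated_map; [apply seq_NoDup|]. intros a b Ha Hb Hab.
            pose proof (th_sub_neq_0 _ _ Hz). pose proof (Hx0 a Ha). pose proof (Hx0 b Hb).
            pose proof (th_sub_neq_0 _ _ (Hx0 a Ha)).
            unfold replace_at.
            destruct (Nat.eqb_spec a k), (Nat.eqb_spec b k); try congruence;
              destruct (Nat.eqb_spec a i), (Nat.eqb_spec b i); try congruence;
              try assumption; unfold y; apply Hxs; congruence.
          + cbn [seq map]. rewrite replace_at_same. f_equal. apply map_replace_at_notin.
            intros Hk. now apply in_seq in Hk; lia.
        - intros j Hj. apply Hreg. simpl in Hj. rewrite length_map in Hj. unfold S' in Hj.
          rewrite length_seq in Hj. lia. }
      rewrite HP. cbn [map]. rewrite (replace_at_other xs i x0 k) by congruence. fold y.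
      pose proof (bethe_coef_cons s x0 xs k S' i Hs0 Hsm (Hx0 i Hi')
        (Hxs k i Hkm Hi' (not_eq_sym Hik)) Hik) as HB. fold y in HB.
      apply (lin_comb1 (lam (xs i) * Bprod tau (y :: map (replace_at xs i x0) S') v e)%cx
               _ _ _ _ HB). ring. }
    cbn [map Bprod] in *. fold y. rewrite replace_at_same.
    rewrite (map_replace_at_notin xs k x0 S') by (intros Hk; apply HS in Hk; tauto).
    match type of HSum with (_ * ?a - _ * ?b = _ * ?c)%cx =>
      set (X1 := a) in *; set (X2 := b) in *; set (X3 := c) in * end.
    set (A0 := Cprod _ S'). set (A1 := Cprod _ S'). unfold bethe_factor.
    apply (lin_comb1 (- (kap * (rho / th s)))%cx _ _ _ _ HSum).
    field. auto.
Qed.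

(** * Extreme vectors *)

Lemma column_zero x tau a e : forall i, col x tau i a e (fun _ => C0) = C0.
Proof using.
  intros i. rewrite (column_ext p g mu x tau a e _ (fun f => C0 * C0 + C0 * C0)%cx).
  - rewrite column_lin. ring.
  - intros. ring.
Qed.

Lemma hsum_repeat_true n : hsum (repeat true n) = INR n.
Proof using. induction n; [reflexivity|]. rewrite S_INR. simpl. rewrite IHn. ring. Qed.

Lemma hsum_repeat_false n : hsum (repeat false n) = - INR n.
Proof using. induction n; [simpl; ring|]. rewrite S_INR. simpl. rewrite IHn. ring. Qed.

Lemma vac_cons_true n f : vac (S n) (true :: f) = vac n f.
Proof using.
  unfold vac. cbn [repeat].
  destruct (list_eq_dec Bool.bool_dec (true :: f) (true :: repeat true n)) as [E|E],
    (list_eq_dec Bool.bool_dec f (repeat true n)) as [E'|E']; congruence.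
Qed.

Lemma vac_cons_false n f : vac (S n) (false :: f) = C0.
Proof using.
  unfold vac. cbn [repeat]. destruct list_eq_dec; [discriminate|reflexivity].
Qed.

(** Only the entries b_- = [s+g][x]/[s] contribute on the all-up vector; their dynamical ratios
    telescope over the sites. *)
Lemma D_vacuum x tau n : forall i e, length e = n ->
  (forall j, (j <= n)%nat -> th (tau + g - RtoC (INR j) * g)%cx <> C0) ->
  (col x tau i false e (vac n)
   = th (tau + g) / th (tau + g - RtoC (INR n) * g)
     * Cprod (fun j => th (x - mu j)) (seq i n) * vac n e)%cx.
Proof using.
  induction n as [|n IH]; intros i e He Ht.
  - destruct e; [|discriminate]. cbn [column Cprod fold_right seq].
    specialize (Ht 0%nat (le_n _)).
    assert (E : (tau + g - RtoC (INR 0) * g = tau + g)%cx) by cplx_ring.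
    rewrite E in *. field. exact Ht.
  - destruct e as [|b' r]; [discriminate|]. injection He as He.
    assert (Htrue : forall a, col x tau (S i) a r (fun f => vac (S n) (true :: f))
                              = col x tau (S i) a r (vac n)).
    { intros a. apply column_ext. intros. apply vac_cons_true. }
    assert (Hfalse : forall a, col x tau (S i) a r (fun f => vac (S n) (false :: f)) = C0).
    { intros a. rewrite (column_ext p g mu x tau a r _ (fun _ => C0)).
      - apply column_zero.
      - intros. apply vac_cons_false. }
    cbn [column]. unfold sum_bool. rewrite !Htrue, !Hfalse.
    rewrite (IH (S i) r He) by (intros; apply Ht; lia).
    destruct b'; cbn [Rel]; [|rewrite vac_cons_false; ring].
    rewrite vac_cons_true.
    destruct (list_eq_dec Bool.bool_dec r (repeat true n)) as [E|E].
    + rewrite E, hsum_repeat_true. cbn [seq Cprod fold_right].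
      fold (Cprod (fun j => th (x - mu j)%cx) (seq (S i) n)).
      replace (tau - g * RtoC (INR n) + g)%cx with (tau + g - RtoC (INR n) * g)%cx by ring.
      replace (tau - g * RtoC (INR n))%cx with (tau + g - RtoC (INR (S n)) * g)%cx
        by (rewrite S_INR; cplx_ring).
      field. split; apply Ht; lia.
    + replace (vac n r) with C0; [ring|]. unfold vac. destruct list_eq_dec; [contradiction|reflexivity].
Qed.

(** On the all-down row only a_- = [x+g] survives, so no dynamical ratio appears. *)
Lemma D_covacuum x tau n w : forall i,
  (col x tau i false (repeat false n) w
   = Cprod (fun j => th (x - mu j + g)) (seq i n) * w (repeat false n))%cx.
Proof using.
  revert w. induction n as [|n IH]; intros w i.
  - simpl. ring.
  - cbn [repeat column]. unfold sum_bool. cbn [Rel]. rewrite (IH (fun f => w (false :: f))).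
    cbn [seq Cprod fold_right]. fold (Cprod (fun j => th (x - mu j + g)%cx) (seq (S i) n)). ring.
Qed.

Lemma Csum_list_states (F : list bool -> Cplx) n :
  Csum_list (map F (states (S n)))
  = Csum_list (map (fun f => F (true :: f) + F (false :: f))%cx (states n)).
Proof using.
  cbn [states]. induction (states n) as [|f l IH]; [reflexivity|].
  cbn [flat_map app map Csum_list fold_right]. fold Csum_list.
  unfold Csum_list in *. rewrite IH. ring.
Qed.

Lemma Csum_list_lin4 (k1 k2 k3 k4 : Cplx) (F1 F2 F3 F4 : list bool -> Cplx) l :
  Csum_list (map (fun f => k1 * F1 f + k2 * F2 f + (k3 * F3 f + k4 * F4 f))%cx l)
  = (k1 * Csum_list (map F1 l) + k2 * Csum_list (map F2 l)
     + (k3 * Csum_list (map F3 l) + k4 * Csum_list (map F4 l)))%cx.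
Proof using.
  unfold Csum_list. induction l as [|a l IH]; simpl; [ring|]. rewrite IH. ring.
Qed.

(** The bridge from the matrix elements that define Z to the recursive operators used in all
    exchange arguments. *)
Lemma mono_column x tau v : forall e i a,
  Csum_list (map (fun f => mono p g mu x tau i a false e f * v f)%cx (states (length e)))
  = col x tau i a e v.
Proof using.
  intros e. revert v. induction e as [|b' r IH]; intros v i a.
  - destruct a; unfold Csum_list; simpl; ring.
  - cbn [length]. rewrite Csum_list_states. cbn [column]. unfold sum_bool. rewrite <- !IH.
    set (s := (tau - g * RtoC (hsum r))%cx).
    rewrite <- Csum_list_lin4. f_equal. apply map_ext. intros f.
    cbn [mono]. unfold Csum_list. cbn [map fold_right]. fold s. ring.
Qed.

Lemma prodB_Bprod L tau xs v : forall m k e, length e = L ->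
  prodB p g L mu tau xs k m v e = Bprod (tau + RtoC (INR k) * g)%cx (map xs (seq k m)) v e.
Proof using.
  induction m as [|m IH]; intros k e He; [reflexivity|].
  cbn [prodB seq map Bprod]. unfold applyB, Bel. subst L. rewrite mono_column.
  apply column_ext. intros f Hf _. rewrite IH by exact Hf.
  replace (tau + RtoC (INR (S k)) * g)%cx with (tau + RtoC (INR k) * g + g)%cx
    by (rewrite S_INR; cplx_ring). reflexivity.
Qed.

(* The left-hand side of the identity in the header. *)
Definition bethe_sum (L : nat) (tau x : Cplx) (xs : nat -> Cplx) : Cplx :=
  (Cprod (fun j => bethe_factor x (xs j)) (seq 1 L) * Cprod (fun j => th (x - mu j)) (seq 1 L)
     * Zpf p g L mu tau xs
   - Csum (fun i => bethe_coef (tauL g L tau) x xs (seq 1 L) i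
       * Cprod (fun j => th (xs i - mu j)) (seq 1 L)
       * Zpf p g L mu tau (replace_at xs i x)) (seq 1 L))%cx.

Lemma bethe_sum_eq L tau x xs :
  (2 <= L)%nat ->
  (forall m : Z, (1 - Z.of_nat L <= m <= 2 * Z.of_nat L)%Z ->
     th (tau + RtoC (IZR m) * g)%cx <> C0) ->
  (forall j, (1 <= j <= L)%nat -> th (x - xs j)%cx <> C0) ->
  (forall i j, (1 <= i <= L)%nat -> (1 <= j <= L)%nat -> i <> j -> th (xs i - xs j)%cx <> C0) ->
  bethe_sum L tau x xs
  = (Cprod (fun j => th (x - mu j + g)) (seq 1 L) * Zpf p g L mu (tau + g) xs)%cx.
Proof using Hp.
  intros HL Ht Hx Hxs. unfold bethe_sum, Zpf.
  set (e := repeat false L). assert (He : length e = L) by apply repeat_length.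
  rewrite !prodB_Bprod by exact He. change (RtoC (INR 1)) with C1.
  replace (tau + g + C1 * g)%cx with (tau + g + g)%cx by ring.
  replace (tau + C1 * g)%cx with (tau + g)%cx by ring.
  rewrite (Csum_ext _ (fun i => bethe_coef (tauL g L tau) x xs (seq 1 L) i
       * Cprod (fun j => th (xs i - mu j)) (seq 1 L)
       * Bprod (tau + g) (map (replace_at xs i x) (seq 1 L)) (vac L) e)%cx).
  2: { intros i _. rewrite prodB_Bprod by exact He. change (RtoC (INR 1)) with C1.
       replace (tau + C1 * g)%cx with (tau + g)%cx by ring. reflexivity. }
  unfold e at 3.
  (* The right side is read as D(x; tau+g) acting on the all-down row, which is then evaluated a
     second time by moving D to the vacuum. *)
  rewrite <- (D_covacuum x (tau + g)%cx L (Bprod (tau + g + g)%cx (map xs (seq 1 L)) (vac L)) 1).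
  fold e.
  assert (Es : (tau + g - g * RtoC (hsum e) = tauL g L tau)%cx).
  { unfold e, tauL. rewrite hsum_repeat_false, S_INR. cplx_ring. }
  assert (Ht' : forall (a : Z) z, z = (tau + RtoC (IZR a) * g)%cx ->
    (1 - Z.of_nat L <= a <= 2 * Z.of_nat L)%Z -> th z <> C0) by (intros a z ->; apply Ht).
  rewrite (D_through_B L xs (vac L)
    (th (tau + g + RtoC (INR L) * g + g) / th (tau + g + g))%cx
    (fun x => Cprod (fun j => th (x - mu j)%cx) (seq 1 L)) L 1 (tau + g)%cx e x).
  - rewrite Es.
    replace (tauL g L tau + g - RtoC (INR L) * g)%cx with (tau + g + g)%cx
      by (unfold tauL; rewrite S_INR; cplx_ring).
    replace (tauL g L tau + g)%cx with (tau + g + RtoC (INR L) * g + g)%cx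
      by (unfold tauL; rewrite S_INR; cplx_ring).
    field. split.
    + apply (Ht' (Z.of_nat L + 2)%Z); [rewrite plus_IZR, <- INR_IZR_INZ; cplx_ring|lia].
    + apply (Ht' 2%Z); [cplx_ring|lia].
  - exact He.
  (* With |m| <= L and 0 <= j < L, the shift m + j + 1 sweeps out the window from 1-L to 2L. *)
  - intros j Hj m Hm. apply (Ht' (m + Z.of_nat j + 1)%Z).
    + rewrite !plus_IZR, <- INR_IZR_INZ. cplx_ring.
    + lia.
  - intros j Hj. rewrite Es. apply (Ht' (Z.of_nat L + 2 - Z.of_nat j)%Z); [|lia].
    unfold tauL. rewrite minus_IZR, plus_IZR, <- !INR_IZR_INZ, S_INR. cplx_ring.
  - intros j Hj. apply in_seq in Hj. apply Hx. lia.
  - intros i j Hi Hj. apply in_seq in Hi. apply in_seq in Hj. apply Hxs; lia.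
  - intros y f Hf. rewrite D_vacuum; [|exact Hf|].
    + replace (tau + g + RtoC (INR L) * g + g - RtoC (INR L) * g)%cx with (tau + g + g)%cx by ring.
      reflexivity.
    + intros j Hj. apply (Ht' (Z.of_nat L + 2 - Z.of_nat j)%Z); [|lia].
      rewrite minus_IZR, plus_IZR, <- !INR_IZR_INZ. cplx_ring.
Qed.

(* For L = 1 the factor [tau+(L+2)g] that cancels in [bethe_sum_eq] is allowed to vanish. *)
Lemma bethe_sum_eq_1 tau x xs :
  th (tau + g)%cx <> C0 -> th (tau + g + g)%cx <> C0 -> th (x - xs 1%nat)%cx <> C0 ->
  bethe_sum 1 tau x xs = (th (x - mu 1%nat + g) * Zpf p g 1 mu (tau + g) xs)%cx.
Proof using Hp.
  intros H1 H2 Hx. unfold bethe_sum, Zpf.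
  rewrite !prodB_Bprod by reflexivity. cbn [seq Csum fold_right].
  rewrite prodB_Bprod by reflexivity. change (RtoC (INR 1)) with C1.
  unfold bethe_coef, bethe_factor, tauL.
  cbn [repeat seq map Bprod column Csum Cprod fold_right Nat.eqb hsum Rel sum_bool].
  unfold sum_bool. cbn [Rel]. rewrite replace_at_same.
  replace (tau + C1 * g - g * RtoC 0)%cx with (tau + g)%cx by cplx_ring.
  replace (tau + g + C1 * g - g * RtoC 0)%cx with (tau + g + g)%cx by cplx_ring.
  replace (tau + RtoC (INR 2) * g)%cx with (tau + g + g)%cx by cplx_ring.
  set (s := (tau + g)%cx) in *.
  set (u := (x - mu 1%nat)%cx). set (w := (xs 1%nat - mu 1%nat)%cx).
  replace (x - xs 1%nat)%cx with (u - w)%cx in * by (unfold u, w; ring).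
  apply (Cmul_cancel_l (th (u - w) * th s * th (s + g))%cx).
  { apply Cmul_neq_0; [apply Cmul_neq_0|]; assumption. }
  (* For one site, Z is [s-w][g]/[s] times the vacuum component, so after clearing denominators the
     claim is a multiple of [th_DB3]. *)
  apply (lin_comb1 (- (th g * vac 1 [true]))%cx _ _ _ _ (th_DB3 p Hp u w s g)).
  field. auto.
Qed.
End Transfer.

(** * Elimination and comparison with the stated coefficients *)

Lemma Csum_1_seq L f : Csum_1 L f = Csum f (seq 1 L).
Proof. unfold Csum_1. now rewrite Csum_nat_Csum, <- Csum_map, seq_shift. Qed.

Lemma Cprod_1_seq L f : Cprod_1 L f = Cprod f (seq 1 L).
Proof.
  unfold Cprod_1. induction L as [|L IH]; [reflexivity|].
  cbn [Cprod_nat]. rewrite IH, seq_S, Cprod_app. simpl. ring.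
Qed.

Lemma Cprod_div {I : Type} (f h : I -> Cplx) l :
  (forall i, In i l -> h i <> C0) ->
  Cprod (fun i => f i / h i)%cx l = (Cprod f l / Cprod h l)%cx.
Proof.
  intros H. apply (Cmul_cancel_l (Cprod h l)); [now apply Cprod_neq_0|].
  rewrite <- Cprod_mul. transitivity (Cprod f l).
  - apply Cprod_ext. intros i Hi. field. auto.
  - field. now apply Cprod_neq_0.
Qed.

Theorem theorem4p1 (p : R) (g : Cplx) (L : nat) (mu : nat -> Cplx)
  (tau x0 x0b : Cplx) (xs : nat -> Cplx) :
  0 < p < 1 -> (1 <= L)%nat ->
  (* genericity: every theta-function appearing in a denominator is nonzero *)
  (forall m : Z, (1 - Z.of_nat L <= m <= 2 * Z.of_nat L)%Z ->
     theta p (Cadd tau (Cmul (RtoC (IZR m)) g)) <> C0) ->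
  (forall j, (1 <= j <= L)%nat ->
     theta p (Csub x0 (xs j)) <> C0 /\ theta p (Csub x0b (xs j)) <> C0 /\
     theta p (Cadd (Csub x0 (mu j)) g) <> C0) ->
  (forall i j, (1 <= i <= L)%nat -> (1 <= j <= L)%nat -> i <> j ->
     theta p (Csub (xs i) (xs j)) <> C0) ->
  Cadd (Cadd (Cmul (M0 p g L mu x0 x0b xs) (Zpf p g L mu tau xs))
             (Csum_1 L (fun i => Cmul (Ni p g L mu tau x0 x0b xs i)
                                      (Zpf p g L mu tau (replace_at xs i x0)))))
       (Csum_1 L (fun i => Cmul (Nbi p g L mu tau x0b xs i)
                                (Zpf p g L mu tau (replace_at xs i x0b))))
  = C0.
Proof.
  intros Hp HL Ht Hx Hxs.
  assert (Hx0 : forall j, In j (seq 1 L) -> theta p (x0 - xs j)%cx <> C0).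
  { intros j Hj. apply in_seq in Hj. destruct (Hx j) as (H & _ & _); [lia|exact H]. }
  assert (Hx0b : forall j, In j (seq 1 L) -> theta p (x0b - xs j)%cx <> C0).
  { intros j Hj. apply in_seq in Hj. destruct (Hx j) as (_ & H & _); [lia|exact H]. }
  assert (Hmu : forall j, In j (seq 1 L) -> theta p (x0 - mu j + g)%cx <> C0).
  { intros j Hj. apply in_seq in Hj. destruct (Hx j) as (_ & _ & H); [lia|exact H]. }
  clear Hx.
  (* The final combination is P(x0b)/P(x0) times the identity at x0 minus the identity at x0b. Only
     P(x0) is inverted, which matches the denominators [x0-mu_j+g] of the theorem. *)
  set (P := fun x => Cprod (fun j => theta p (x - mu j + g)%cx) (seq 1 L)).
  assert (HP : P x0 <> C0).
  { now apply Cprod_neq_0. }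
  (* The point is that the same [Z'] serves both x0 and x0b; the existential also hides the separate
     treatment of L = 1. *)
  assert (HG : exists Z', forall x, (forall j, In j (seq 1 L) -> theta p (x - xs j)%cx <> C0) ->
                bethe_sum p g mu L tau x xs = (P x * Z')%cx).
  { exists (Zpf p g L mu (tau + g)%cx xs). intros x Hxj.
    assert (Hxj' : forall j, (1 <= j <= L)%nat -> theta p (x - xs j)%cx <> C0)
      by (intros j Hj; apply Hxj, in_seq; lia).
    destruct (Nat.eq_dec L 1) as [->|HL1].
    - rewrite bethe_sum_eq_1; auto.
      + unfold P. simpl. ring.
      + replace (tau + g)%cx with (tau + RtoC (IZR 1) * g)%cx by cplx_ring. apply Ht. lia.
      + replace (tau + g + g)%cx with (tau + RtoC (IZR 2) * g)%cx by cplx_ring. apply Ht. lia.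
    - apply bethe_sum_eq; auto. lia. }
  destruct HG as (Z' & HG).
  assert (E0 : bethe_sum p g mu L tau x0 xs = (P x0 * Z')%cx) by (apply HG; assumption).
  assert (E1 : bethe_sum p g mu L tau x0b xs = (P x0b * Z')%cx) by (apply HG; assumption).
  assert (HM : M0 p g L mu x0 x0b xs
    = (P x0b / P x0 * (Cprod (fun j => bethe_factor p g x0 (xs j)) (seq 1 L)
                        * Cprod (fun j => theta p (x0 - mu j)) (seq 1 L))
       - Cprod (fun j => bethe_factor p g x0b (xs j)) (seq 1 L)
         * Cprod (fun j => theta p (x0b - mu j)) (seq 1 L))%cx).
  { unfold M0. rewrite !Cprod_1_seq. f_equal.
    - unfold P. rewrite <- Cprod_div, <- !Cprod_mul
        by exact Hmu.
      apply Cprod_ext. intros j Hj. unfold bethe_factor. field.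
      specialize (Hmu j Hj). specialize (Hx0 j Hj). auto.
    - f_equal. rewrite <- !Cprod_mul. apply Cprod_ext.
      intros j Hj. unfold bethe_factor. field. now apply Hx0b. }
  assert (HB : forall x i, (theta p g * theta p (x - xs i + tauL g L tau)
         / (theta p (tauL g L tau) * theta p (x - xs i))
       * Cprod_1_ne L i (fun j => theta p (xs i - xs j + g) / theta p (xs i - xs j))
     = bethe_coef p g (tauL g L tau) x xs (seq 1 L) i)%cx).
  { intros x i. unfold Cprod_1_ne. rewrite Cprod_1_seq. unfold bethe_coef, bethe_factor.
    now replace (tauL g L tau + (x - xs i))%cx with (x - xs i + tauL g L tau)%cx by ring. }
  assert (HN : forall i, Ni p g L mu tau x0 x0b xs i
    = (- (P x0b / P x0) * (bethe_coef p g (tauL g L tau) x0 xs (seq 1 L) i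
         * Cprod (fun j => theta p (xs i - mu j)) (seq 1 L)))%cx).
  { intros i. unfold Ni. rewrite <- HB, Cprod_1_seq.
    replace (P x0b / P x0 )%cx
      with (Cprod (fun j => theta p (x0b - mu j + g) / theta p (x0 - mu j + g))%cx (seq 1 L)).
    - rewrite (Cprod_ext _ (fun j => theta p (xs i - mu j)
         * (theta p (x0b - mu j + g) / theta p (x0 - mu j + g)))%cx), Cprod_mul; [ring|].
      intros j Hj. field. now apply Hmu.
    - apply Cprod_div. exact Hmu. }
  assert (HNb : forall i, Nbi p g L mu tau x0b xs i
    = (bethe_coef p g (tauL g L tau) x0b xs (seq 1 L) i
         * Cprod (fun j => theta p (xs i - mu j)) (seq 1 L))%cx).
  { intros i. unfold Nbi. rewrite <- HB, Cprod_1_seq. ring. }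
  rewrite HM, !Csum_1_seq.
  rewrite (Csum_ext _ (fun i => - (P x0b / P x0) * (bethe_coef p g (tauL g L tau) x0 xs (seq 1 L) i
         * Cprod (fun j => theta p (xs i - mu j)) (seq 1 L)
         * Zpf p g L mu tau (replace_at xs i x0)))%cx) by (intros i _; rewrite HN; ring).
  rewrite Csum_scal.
  rewrite (Csum_ext (fun i => Nbi p g L mu tau x0b xs i * _)%cx (fun i => bethe_coef p g (tauL g L tau) x0b xs (seq 1 L) i
         * Cprod (fun j => theta p (xs i - mu j)) (seq 1 L)
         * Zpf p g L mu tau (replace_at xs i x0b))%cx) by (intros i _; rewrite HNb; ring).
  unfold bethe_sum in E0, E1.
  apply (lin_comb2 (P x0b / P x0)%cx (- C1)%cx _ _ _ _ _ _ E0 E1).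
  field. exact HP.
Qed.
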